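(* Let $p\in\mathbb{C}[z_1,z_2]$ be scattering stable of bidegree $n=(n_1,n_2)$ and let $f=\frac{p+\tilde p}{p-\tilde p}\in PRPR_2$ (in particular $\tilde p(0,0)=0$). Let $v\in\mathbb{C}[z_1,z_2]$ be a polynomial of bidegree at most $n$ with $v=\tilde v$, $v(0,0)=0$, such that $p+v$ and $p-av$ have no zeros in $\mathbb{D}^2$ for some $a>0$, and such that $$g=f+2\frac{v}{p-\tilde p}$$ belongs to the face $\mathcal{F}(f)$ of $f$ in $PRP_2$. Suppose $p(\zeta)=0$ for some $\zeta\in\mathbb{T}^2$. Then $$I_\zeta(p,\tilde p)\le I_\zeta(p+v,\tilde p+v).$$
   Context: $\mathbb{D}$ is the open unit disk, $\mathbb{T}$ the unit circle. $PRP_2$ is the convex set of holomorphic functions $f:\mathbb{D}^2\to\{w\in\mathbb{C}:\operatorname{Re}w>0\}$ with $f(0,0)=1$; $PRPR_2$ is the set of $f\in PRP_2$ for which $F=\frac{f-1}{f+1}$ is a rational inner function (rational, holomorphic from $\mathbb D^2$ to $\overline{\mathbb D}$, with $|F(rz)|\to1$ as $r\nearrow1$ for almost every $z\in\mathbb{T}^2$). For an element $x$ of a convex set $S$, the face $\mathcal{F}(x)$ is the union of all line segments $L\subset S$ having $x$ in the interior of $L$, with $\mathcal{F}(x)=\{x\}$ if $x$ is extreme. For $q$ of bidegree at most $n$, the reflection at bidegree $n$ is $\tilde q(z)=z_1^{n_1}z_2^{n_2}\overline{q(1/\bar z_1,1/\bar z_2)}$; $\tilde p$ and $\tilde v$ are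 both taken at $n$, the bidegree of $p$. $p$ is scattering stable if it has no zeros in $\mathbb{D}^2$ and $p,\tilde p$ have no nonconstant common factor. (Every element of $\mathcal{F}(f)$ can be written as $g$ with $v$ having the listed properties; this is a known theorem of McDonald.) $I_\zeta(p,q)=\dim_{\mathbb{C}}\mathcal{O}_\zeta/(p,q)\mathcal{O}_\zeta\in\{0,1,2,\dots\}\cup\{\infty\}$ is the intersection multiplicity at $\zeta$, where $\mathcal{O}_\zeta$ is the ring of rational functions with denominators nonvanishing at $\zeta$. *)

(* Defs.v *)
From HB Require Import structures.
From mathcomp Require Import all_boot all_order all_algebra.
From mathcomp Require Import fraction polyXY.
From mathcomp Require Import all_classical all_reals all_analysis.
From mathcomp Require Import complex ring.

Set Implicit Arguments.
Unset Strict Implicit.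
Unset Printing Implicit Defensive.

Import Order.TTheory GRing.Theory Num.Theory.
Import numFieldNormedType.Exports.
Local Open Scope classical_set_scope.
Local Open Scope ring_scope.
Local Open Scope complex_scope.

(* [R[i]^o] is [R[i]] with its topology and its structure of normed module over
   itself, so [differentiable] on [R[i]^o * R[i]^o] means complex (Frechet)
   differentiable. *)

Section Faces.
Variables (R : realType) (V : lmodType R[i]).
Implicit Types (S : set V) (x y a b : V).

Definition segment a b : set V :=
  [set y | exists2 t : R, 0 <= t <= 1 & y = (1 - t)%:C *: a + t%:C *: b].

Definition open_segment a b : set V :=
  [set y | exists2 t : R, 0 < t < 1 & y = (1 - t)%:C *: a + t%:C *: b].

Definition segment_through S x a b : Prop :=
  [/\ a != b, segment a b `<=` S & open_segment a b x].

Definition extreme S x : Prop :=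
  S x /\ ~ exists a b, segment_through S x a b.

Definition face S x : set V :=
  [set y | (exists a b, segment_through S x a b /\ segment a b y)
           \/ (extreme S x /\ y = x)].

End Faces.

Section Bidisk.
Variable R : realType.
Local Notation C := (R[i]^o).
Implicit Types (f F : C * C -> C) (p q v : {poly {poly R[i]}}).

Definition bidisk : set (C * C) := [set z | `|z.1| < 1 /\ `|z.2| < 1].

Definition torus : set (C * C) := [set z | `|z.1| = 1 /\ `|z.2| = 1].

(* A function on the bidisk is encoded as a total function vanishing off the
   bidisk, so that [=] is equality of functions on the bidisk. *)
Definition on_bidisk f : C * C -> C := patch (fun=> 0) bidisk f.

Definition holomorphic_bidisk f : Prop :=
  forall z, bidisk z -> differentiable f z.

Definition PRP2 : set (C * C -> C) :=
  [set f | [/\ on_bidisk f = f,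
               holomorphic_bidisk f,
               forall z, bidisk z -> 0 < complex.Re (f z)
             & f (0, 0) = 1]].

(* The paper's [z_1] is the outer variable ['X] and [z_2] is ['Y = 'X%:P]:
   [p`_i`_j] is the coefficient of [z_1^i z_2^j], and [p.[x, y] = p(x, y)]. *)
Definition rational_bidisk F : Prop :=
  exists p q, q != 0 /\
    forall z, bidisk z -> q.[z.1, z.2] != 0 ->
      F z = p.[z.1, z.2] / q.[z.1, z.2].

Definition expi (t : R) : R[i] := cos t +i* sin t.

(* Null sets of the torus are taken with respect to the angles (s, t) in
   [0, 2 pi]^2. *)
Definition rational_inner F : Prop :=
  [/\ rational_bidisk F,
      holomorphic_bidisk F,
      forall z, bidisk z -> `|F z| <= 1
    & {ae ((@lebesgue_measure R) \x (@lebesgue_measure R))%E,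
        forall st : measurableTypeR R * measurableTypeR R,
        (0 <= st.1 <= pi *+ 2) && (0 <= st.2 <= pi *+ 2) ->
        (`|F (r%:C * expi st.1, r%:C * expi st.2)| : C) @[r --> (1 : R)^'-]
          --> (1 : C)}].

Definition PRPR2 : set (C * C -> C) :=
  [set f | PRP2 f /\ rational_inner (fun z => (f z - 1) / (f z + 1))].

Definition bidegree_le (n : nat * nat) q : Prop :=
  (size q <= n.1.+1)%N /\ (sizeY q <= n.2.+1)%N.

Definition bidegree (n : nat * nat) q : Prop :=
  size q = n.1.+1 /\ sizeY q = n.2.+1.

(* The coefficients of z_1^n1 z_2^n2 conj(q(1/conj z_1, 1/conj z_2)), for [q]
   of bidegree at most [n]; see [horner2_reflect]. *)
Definition reflect_poly (n : nat * nat) q : {poly {poly R[i]}} :=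
  \poly_(i < n.1.+1) \poly_(j < n.2.+1) (q`_(n.1 - i)`_(n.2 - j))^*.

Definition zero_free_bidisk q : Prop :=
  forall z, bidisk z -> q.[z.1, z.2] != 0.

Definition scattering_stable (n : nat * nat) p : Prop :=
  zero_free_bidisk p /\
  forall d a b, p = a * d -> reflect_poly n p = b * d ->
    exists c : R[i], d = c%:P%:P.

Definition frac_bidisk p q : C * C -> C :=
  on_bidisk (fun z => p.[z.1, z.2] / q.[z.1, z.2]).

End Bidisk.

Section IntersectionMultiplicity.
Variable R : realType.
Local Notation K := (R[i]).
Local Notation L := {fraction {poly {poly K}}}.
Local Notation "x %:F" := (@FracField.tofrac _ x).
Implicit Types (p q : {poly {poly K}}) (z : K * K).

Definition local_ring z : set L :=
  [set x | exists a b : {poly {poly K}}, b.[z.1, z.2] != 0 /\ x = a%:F / b%:F].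

Definition local_ideal z p q : set L :=
  [set x | exists a b, [/\ local_ring z a, local_ring z b
                         & x = a * p%:F + b * q%:F]].

(* The classes of the [e i] in the quotient by [J] are linearly independent
   over the constants [K]. *)
Definition free_mod (J : set L) (k : nat) (e : 'I_k -> L) : Prop :=
  forall c : 'I_k -> K,
    J (\sum_(i < k) ((c i)%:P%:P)%:F * e i) -> forall i, c i = 0.

(* dim_K (V / J), in {0, 1, 2, ...} with +oo in infinite dimension: the
   supremum of the sizes of the linearly independent families of V / J. *)
Definition dim_mod (V J : set L) : \bar R :=
  ereal_sup [set (k%:R)%:E | k in
    [set k | exists e : 'I_k -> L, (forall i, V (e i)) /\ free_mod J e]].

Definition intersection_mult z p q : \bar R :=
  dim_mod (local_ring z) (local_ideal z p q).

End IntersectionMultiplicity.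

Lemma horner2_bidegree (K : comNzRingType) (m n : nat) (q : {poly {poly K}})
    (x y : K) :
  (size q <= m)%N -> (sizeY q <= n)%N ->
  q.[x, y] = \sum_(i < m) \sum_(j < n) q`_i`_j * y ^+ j * x ^+ i.
Proof.
move=> sq1 sq2; rewrite (horner_coef_wide _ sq1) horner_sum.
apply: eq_bigr => i _; rewrite -rmorphXn/= hornerM hornerC.
by rewrite (horner_coef_wide _ (leq_trans (max_size_coefXY _ _) sq2)) mulr_suml.
Qed.

Lemma horner2_reflect_gen (K : fieldType) (s : {rmorphism K -> K}) (m n : nat)
    (q : {poly {poly K}}) (x y a b : K) :
  (size q <= m.+1)%N -> (sizeY q <= n.+1)%N ->
  s a * x = 1 -> s b * y = 1 ->
  (\poly_(i < m.+1) \poly_(j < n.+1) s q`_(m - i)`_(n - j)).[x, y] =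
    x ^+ m * y ^+ n * s (q.[a, b]).
Proof.
move=> sq1 sq2 ax by1; rewrite (horner2_bidegree _ _ sq1 sq2).
rewrite horner_poly horner_sum rmorph_sum mulr_sumr (reindex_inj rev_ord_inj).
apply: eq_bigr => -[i im] _.
have im' : (i <= m)%N by [].
have e1 : (m - (m.+1 - i.+1) = i)%N by rewrite subSS subKn.
have e2 : (m.+1 - i.+1 = m - i)%N by rewrite subSS.
rewrite [nat_of_ord _]/= e1 e2 [nat_of_ord _]/=.
rewrite -rmorphXn hornerM hornerC horner_poly mulr_suml rmorph_sum mulr_sumr.
rewrite (reindex_inj rev_ord_inj).
apply: eq_bigr => -[j jn] _.
have jn' : (j <= n)%N by [].
have f1 : (n - (n.+1 - j.+1) = j)%N by rewrite subSS subKn.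
have f2 : (n.+1 - j.+1 = n - j)%N by rewrite subSS.
rewrite [nat_of_ord _]/= f1 f2 [nat_of_ord _]/= !rmorphM !rmorphXn.
have -> : x ^+ m = x ^+ (m - i) * x ^+ i by rewrite -exprD subnK.
have -> : y ^+ n = y ^+ (n - j) * y ^+ j by rewrite -exprD subnK.
have xi : s a ^+ i * x ^+ i = 1 by rewrite -exprMn ax expr1n.
have yj : s b ^+ j * y ^+ j = 1 by rewrite -exprMn by1 expr1n.
transitivity (s q`_i`_j * y ^+ (n - j) * x ^+ (m - i) *
  (s a ^+ i * x ^+ i) * (s b ^+ j * y ^+ j)); first by rewrite xi yj !mulr1.
by ring.
Qed.

Lemma horner2_reflect (R : realType) (n : nat * nat) (q : {poly {poly R[i]}})
    (x y : R[i]) :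
  bidegree_le n q -> x != 0 -> y != 0 ->
  (reflect_poly n q).[x, y] =
    x ^+ n.1 * y ^+ n.2 * (q.[(x^*)^-1, (y^*)^-1])^*.
Proof.
have conjV (w : R[i]) : w != 0 -> ((w^*)^-1)^* * w = 1.
  by move=> w0; rewrite fmorphV/= conjCK mulVf.
move=> [sq1 sq2] x0 y0.
exact: (@horner2_reflect_gen _ (@Num.conj R[i]) _ _ _ _ _ _ _ sq1 sq2
  (conjV x x0) (conjV y y0)).
Qed.

(* Main.v *)
Require Import Defs.
From HB Require Import structures.
From mathcomp Require Import all_boot all_order all_algebra.
From mathcomp Require Import fraction polyXY.
From mathcomp Require Import all_classical all_reals all_analysis.
From mathcomp Require Import complex ring.

(* Put [q = p - pt] and [u = p + v]; both multiplicities are colengths modulo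
   [q], of [p] and of [u].  Near a torus point where [q] vanishes, the functions
   [f], [g] and [k f - g] have nonnegative real part and denominator [q]; the
   leading coefficients of their poles along the radius are therefore
   nonnegative, whence [|u| <= k |p|] on the zeros of [q] in the torus.  For
   almost all [z_2] on the circle, all zeros of [q(., z_2)] lie on the circle, so
   that the characteristic polynomial of [u / p] modulo [q] over the rational
   functions of [z_2] has coefficients bounded along the circle, hence regular
   at [zeta_2]: [u] is integral over the ideal [(p)] modulo [q].  (Factors
   [z_2 - zeta_2] of [q] are treated separately.)  Consequently
   [M = (p, u)^k + (q)] satisfies [u M <= p M + (q)] for some [k]; as [p M] has
   colength [dim O/(p, q) + dim O/M] modulo [q], and [u M] has colength at most
   [dim O/(u, q) + dim O/M], the inequality follows. *)

Set Implicit Arguments.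
Unset Strict Implicit.
Unset Printing Implicit Defensive.

Import Order.TTheory GRing.Theory Num.Theory.
Import numFieldNormedType.Exports.
Local Open Scope ring_scope.

(** * Linear independence modulo a subspace *)

(** At a singular point of [q = 0], boundedness of [u / p] does not give [u] in [(p, q)]: it only
    gives integral dependence, which is why colengths have to be compared through an auxiliary ideal
    of finite colength.

    The bound on the torus controls all complex branches because of a symmetry: [q] equals minus its
    reflection, so over a circle value of z_2 the roots in z_1 come in pairs [y], [1 / conj y].
    Freeness of zeros in the bidisk pushes both members out of the open disk. Symmetric functions of
    the values of [u / p] are then rational functions of the single variable z_2, bounded on the
    circle off finitely many points, and such a function has no pole on the circle.

    The constant [k] comes from the face: if [f = (1 - s) a + s b] and [g] lies on the segment from
    [a] to [b], then [1 / (1 - s) + 1 / s] works.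

    Limits are taken by Lipschitz estimates for polynomials, and dimensions are compared by
    transporting independent families, so infinite values need no separate treatment. *)

Section LinearAlgebra.
Variable K : fieldType.
Local Notation Rg := {poly {poly K}}.
Local Notation "c %:K" := (c%:P%:P : Rg) (at level 1, format "c %:K").
Implicit Types (J M : Rg -> Prop).

Definition lin_closed J :=
  J 0 /\ forall (c : K) g h, J g -> J h -> J (c%:K * g + h).

Definition lin_free J (k : nat) (e : 'I_k -> Rg) :=
  forall c : 'I_k -> K, J (\sum_i (c i)%:K * e i) -> forall i, c i = 0.

Definition add_span J (m : nat) (w : 'I_m -> Rg) (h : Rg) :=
  exists d : 'I_m -> K, J (h - \sum_i (d i)%:K * w i).

Lemma lin_closedZ J c g : lin_closed J -> J g -> J (c%:K * g).
Proof. by case=> J0 JD Jg; have := JD c g 0 Jg J0; rewrite addr0. Qed.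

Lemma lin_closedD J g h : lin_closed J -> J g -> J h -> J (g + h).
Proof. by case=> _ JD Jg Jh; have := JD 1 g h Jg Jh; rewrite mul1r. Qed.

Lemma lin_closedB J g h : lin_closed J -> J g -> J h -> J (g - h).
Proof.
by case=> _ JD Jg Jh; have := JD (- 1) h g Jh Jg; rewrite !rmorphN1 mulN1r addrC.
Qed.

Lemma add_span_lin_closed J m (w : 'I_m -> Rg) :
  lin_closed J -> lin_closed (add_span J w).
Proof.
move=> Jl; split=> [|c g h [d Jd] [d' Jd']].
  by exists (fun=> 0); rewrite big1 ?subr0 => [|i _]; [case: Jl|rewrite mul0r].
exists (fun i => c * d i + d' i).
have -> : \sum_i (c * d i + d' i)%:K * w i =
    c%:K * (\sum_i (d i)%:K * w i) + \sum_i (d' i)%:K * w i.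
  rewrite mulr_sumr -big_split; apply: eq_bigr => i _ /=.
  by rewrite !rmorphD !rmorphM /= mulrDl mulrA.
have -> : forall a b x y : Rg, c%:K * a + b - (c%:K * x + y) =
  c%:K * (a - x) + (b - y) by move=> *; ring.
by case: Jl => _; apply.
Qed.

Lemma add_spanS J m (w : 'I_m.+1 -> Rg) h :
  add_span J w h <->
  add_span (add_span J (fun _ : 'I_1 => w ord0)) (fun i => w (lift ord0 i)) h.
Proof.
split=> [[d Jd]|[d [d0 Jd]]].
  exists (fun i => d (lift ord0 i)), (fun=> d ord0).
  by rewrite big_ord1; move: Jd; rewrite big_ord_recl opprD addrA addrAC.
exists (fun i => if unlift ord0 i is Some j then d j else d0 ord0).
rewrite big_ord_recl unlift_none; move: Jd; rewrite big_ord1.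
under [X in _ -> J (_ - (_ + X))]eq_bigr do rewrite liftK.
by rewrite opprD addrA addrAC.
Qed.

Lemma lin_free_sub J J' k (e : 'I_k -> Rg) :
  (forall h, J' h -> J h) -> lin_free J e -> lin_free J' e.
Proof. by move=> sJ fe c /sJ/fe. Qed.

(** Steinitz exchange: if [w] depends on the [e j] modulo [J], a vector with nonzero coefficient is
    given up; otherwise, or if [w] is in [J], any vector will do. *)
Lemma lin_free_quotient1 J (w : Rg) k (e : 'I_k.+1 -> Rg) :
  lin_closed J -> lin_free J e ->
  exists e' : 'I_k -> Rg, lin_free (add_span J (fun _ : 'I_1 => w)) e'.
Proof.
move=> Jl fe.
have drop i c0 : J (\sum_j (c0 j)%:K * e j - w) -> c0 i != 0 ->
    lin_free (add_span J (fun _ : 'I_1 => w)) (fun j => e (lift i j)).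
  move=> Jc ci d [t]; rewrite big_ord1 => Jd.
  pose D j := if unlift i j is Some j' then d j' else 0.
  have ED : \sum_j (D j)%:K * e j = \sum_j (d j)%:K * e (lift i j).
    rewrite (bigD1_ord i) //= /D unlift_none mul0r add0r.
    by apply: eq_bigr => j _; rewrite liftK.
  have : J (\sum_j (D j - t ord0 * c0 j)%:K * e j).
    have -> : \sum_j (D j - t ord0 * c0 j)%:K * e j =
       (\sum_j (d j)%:K * e (lift i j) - (t ord0)%:K * w)
       - (t ord0)%:K * (\sum_j (c0 j)%:K * e j - w).
      rewrite -ED mulrBr opprB addrA subrK mulr_sumr -sumrB.
      by apply: eq_bigr => j _; rewrite !rmorphB !rmorphM /=; ring.
    by apply: lin_closedB => //; exact: lin_closedZ.
  move/fe => D0.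
  (* The dropped [e i] enters the relation only through [w], so its coefficient isolates [t]. *)
  have t0 : t ord0 = 0.
    have := D0 i; rewrite /D unlift_none sub0r => /eqP.
    by rewrite oppr_eq0 mulf_eq0 (negPf ci) orbF => /eqP.
  by move=> j; have := D0 (lift i j); rewrite /D liftK t0 mul0r subr0.
have [[c Jc]|noc] := pselect (exists c : 'I_k.+1 -> K, J (\sum_j (c j)%:K * e j - w)).
  have [/existsP [i ci]|/existsPn c0] := boolP [exists i, c i != 0].
    by exists (fun j => e (lift i j)); exact: drop Jc ci.
  have {}Jc : J w.
    move: Jc; rewrite big1 => [|i _]; last first.
      by have := c0 i; rewrite negbK => /eqP ->; rewrite mul0r.
    by rewrite sub0r => /(lin_closedZ (- 1) Jl); rewrite !rmorphN1 mulN1r opprK.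
  exists (fun j => e (lift ord0 j)) => d [t]; rewrite big_ord1 => Jd.
  have := lin_closedD Jl Jd (lin_closedZ (t ord0) Jl Jc); rewrite subrK => Jd'.
  have := fe (fun i => if unlift ord0 i is Some j then d j else 0).
  rewrite big_ord_recl unlift_none mul0r add0r.
  under eq_bigr do rewrite liftK.
  by move=> /(_ Jd') d0 j; have := d0 (lift ord0 j); rewrite liftK.
exists (fun j => e (lift ord0 j)) => d [t]; rewrite big_ord1 => Jd.
have [t0|t0] := eqVneq (t ord0) 0; last first.
  case: noc; exists (fun i => if unlift ord0 i is Some j then (t ord0)^-1 * d j else 0).
  rewrite big_ord_recl unlift_none mul0r add0r.
  have := lin_closedZ (t ord0)^-1 Jl Jd; rewrite mulrBr mulrA -!rmorphM mulVf //= mul1r.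
  congr (J (_ - _)); rewrite mulr_sumr; apply: eq_bigr => j _.
  by rewrite liftK !rmorphM mulrA.
move: Jd; rewrite t0 mul0r subr0 => Jd.
have := fe (fun i => if unlift ord0 i is Some j then d j else 0).
rewrite big_ord_recl unlift_none mul0r add0r.
under eq_bigr do rewrite liftK.
by move=> /(_ Jd) d0 j; have := d0 (lift ord0 j); rewrite liftK.
Qed.

Lemma lin_free_quotient J m (w : 'I_m -> Rg) k (e : 'I_(m + k) -> Rg) :
  lin_closed J -> lin_free J e ->
  exists e' : 'I_k -> Rg, lin_free (add_span J w) e'.
Proof.
elim: m J w e => [|m IH] J w e Jl fe.
  exists e; apply: lin_free_sub fe => h [d].
  by rewrite big_ord0 subr0.
have [e1 fe1] := lin_free_quotient1 (w ord0) Jl fe.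
have [e2 fe2] := IH _ (fun i => w (lift ord0 i)) e1 (add_span_lin_closed _ Jl) fe1.
by exists e2; apply: lin_free_sub fe2 => h /add_spanS.
Qed.

(** A basis modulo [M] and the first vector is completed by that vector exactly when it lies outside
    [M]. *)
Lemma lin_basis_extract M n (w : 'I_n -> Rg) :
  lin_closed M -> (forall h, add_span M w h) ->
  exists m (b : 'I_m -> Rg), lin_free M b /\ forall h, add_span M b h.
Proof.
elim: n M w => [|n IH] M w Ml sp.
  exists 0%N, w; split=> // c _ [] //.
have [] := IH (add_span M (fun _ : 'I_1 => w ord0)) (fun i => w (lift ord0 i)).
- exact: add_span_lin_closed.
- by move=> h; apply/add_spanS.
move=> m [b [fb spb]].
have [Mw|nMw] := pselect (M (w ord0)).
  exists m, b; split.
    apply: lin_free_sub fb => h Mh; exists (fun=> 0).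
    by rewrite big_ord1 mul0r subr0.
  move=> h; have [d [t]] := spb h; rewrite big_ord1 => Md; exists d.
  by have := lin_closedD Ml Md (lin_closedZ (t ord0) Ml Mw); rewrite subrK.
pose b' (i : 'I_m.+1) := if unlift ord0 i is Some j then b j else w ord0.
have b'l j : b' (lift ord0 j) = b j by rewrite /b' liftK.
have b'0 : b' ord0 = w ord0 by rewrite /b' unlift_none.
exists m.+1, b'; split.
  move=> c; rewrite big_ord_recl b'0.
  under eq_bigr do rewrite b'l.
  move=> Mc; have c0 : forall j, c (lift ord0 j) = 0.
    apply: (fb (fun j => c (lift ord0 j))); exists (fun=> - c ord0).
    by rewrite big_ord1 !rmorphN mulNr opprK addrC.
  move=> i; have [->|/eqP i0] := eqVneq i ord0; last first.
    by case: (unliftP ord0 i) => [j ->|/i0].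
  move: Mc; rewrite big1 ?addr0 => [Mc|j _]; last by rewrite c0 mul0r.
  apply/eqP/negPn/negP => cn0; case: nMw.
  by have := lin_closedZ (c ord0)^-1 Ml Mc; rewrite mulrA -!rmorphM mulVf // mul1r.
move=> h; apply/add_spanS.
have [d [t Mt]] := spb h; exists d, t.
rewrite b'0 [X in _ - X - _](_ : _ = \sum_i (d i)%:K * b i) //.
by apply: eq_bigr => j _; rewrite b'l.
Qed.

End LinearAlgebra.

(** * Ideals of the local ring *)

Section LocalIdeals.
Variables (K : fieldType) (z : K * K).
Local Notation Rg := {poly {poly K}}.
Local Notation "c %:K" := (c%:P%:P : Rg) (at level 1, format "c %:K").
Implicit Types (a b g h m p q s u : Rg) (M : Rg -> Prop).

Definition unit_at s := s.[z.1, z.2] != 0.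

Lemma unit_atM s s' : unit_at s -> unit_at s' -> unit_at (s * s').
Proof. by rewrite /unit_at !hornerM mulf_eq0 negb_or => -> ->. Qed.

Lemma unit_at1 : unit_at 1.
Proof. by rewrite /unit_at !hornerC oner_eq0. Qed.

Lemma unit_atX s k : unit_at s -> unit_at (s ^+ k).
Proof.
move=> us; elim: k => [|k IH]; first by rewrite expr0; exact: unit_at1.
by rewrite exprS; exact: unit_atM.
Qed.

(* The trace on polynomials of the ideal generated by [p] and [q] in the local
   ring at [z]. *)
Definition loc_ideal p q h := exists s a b, unit_at s /\ s * h = a * p + b * q.

(* An ideal of polynomials that is the trace of an ideal of the local ring. *)
Record sat_ideal M : Prop := SatIdeal {
  sat_ideal0 : M 0;
  sat_idealD : forall g h, M g -> M h -> M (g + h);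
  sat_idealM : forall a h, M h -> M (a * h);
  sat_idealP : forall s h, unit_at s -> M (s * h) -> M h }.

Lemma sat_ideal_lin_closed M : sat_ideal M -> lin_closed M.
Proof. by move=> [M0 MD MM _]; split=> // c g h Mg Mh; apply/MD/Mh/MM. Qed.

Lemma loc_ideal_sat p q : sat_ideal (loc_ideal p q).
Proof.
split.
- by exists 1, 0, 0; split; [exact: unit_at1 | rewrite mulr0 !mul0r addr0].
- move=> g h [s [a [b [us e]]]] [s' [a' [b' [us' e']]]].
  exists (s * s'), (s' * a + s * a'), (s' * b + s * b').
  split; first exact: unit_atM.
  have -> : s * s' * (g + h) = s' * (s * g) + s * (s' * h) by ring.
  by rewrite e e'; ring.
- move=> c h [s [a [b [us e]]]]; exists s, (c * a), (c * b); split=> //.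
  have -> : s * (c * h) = c * (s * h) by ring.
  by rewrite e; ring.
- move=> t h ut [s [a [b [us e]]]]; exists (s * t), a, b.
  by split; [exact: unit_atM | rewrite -mulrA].
Qed.

Lemma loc_ideall p q : loc_ideal p q p.
Proof. by exists 1, 1, 0; split; [exact: unit_at1 | ring]. Qed.

Lemma loc_idealr p q : loc_ideal p q q.
Proof. by exists 1, 0, 1; split; [exact: unit_at1 | ring]. Qed.

Section Comparison.
Variables (p q u : Rg) (M : Rg -> Prop).
Hypothesis Mi : sat_ideal M.
Hypothesis Mq : M q.
Hypothesis Mu : forall h, M h ->
  exists s m b, [/\ unit_at s, M m & s * (u * h) = p * m + q * b].
Hypothesis reg : forall a b, p * a = q * b ->
  exists s c, unit_at s /\ s * a = q * c.
Hypothesis Minv : forall s, unit_at s -> exists s', M (1 - s * s').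

(** The trace on polynomials of the ideal [g M + (q)] of the local ring. *)
Let N g h := exists s m b, [/\ unit_at s, M m & s * h = g * m + q * b].

Let N_lin g : lin_closed (N g).
Proof.
have [M0 MD MM _] := Mi.
split; first by exists 1, 0, 0; split=> //; [exact: unit_at1 | ring].
move=> c h k [s [m [b [us Mm e]]]] [s' [m' [b' [us' Mm' e']]]].
exists (s * s'), ((s' * c%:K) * m + s * m'), (s' * c%:K * b + s * b').
split; [exact: unit_atM | by apply: MD; apply: MM | ].
have -> : s * s' * (c%:K * h + k) = s' * c%:K * (s * h) + s * (s' * k) by ring.
by rewrite e e'; ring.
Qed.

(* Multiplication by [p] maps [Rg / M] isomorphically onto
   [(p, q) / (p M + q Rg)], and multiplication by [u] maps it onto
   [(u, q) / (u M + q Rg)], while [u M] lies in [p M + q Rg] up to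
   localization: the finite dimension of [Rg / M] cancels. *)
Lemma lin_free_transfer n (w : 'I_n -> Rg) k (e : 'I_k -> Rg) :
  (forall h, add_span M w h) -> lin_free (loc_ideal p q) e ->
  exists e' : 'I_k -> Rg, lin_free (loc_ideal u q) e'.
Proof.
have [M0 MD MM MP] := Mi.
move=> /(lin_basis_extract (sat_ideal_lin_closed Mi)) [m [b [fb spb]]] fe.
pose E (i : 'I_(m + k)) := match fintype.split i with inl j => p * b j | inr j => e j end.
have fE : lin_free (N p) E.
  move=> c; rewrite big_split_ord /=.
  under eq_bigr => i _ do rewrite /E (unsplitK (inl i : 'I_m + 'I_k)).
  under [X in N p (_ + X)]eq_bigr => i _ do
    rewrite /E (unsplitK (inr i : 'I_m + 'I_k)).
  set X := \sum_i _; set Y := \sum_i _.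
  move=> [s [mu [be [us Mmu eq1]]]].
  pose B := \sum_(i < m) (c (lshift k i))%:K * b i.
  have XB : X = p * B.
    by rewrite /X /B mulr_sumr; apply: eq_bigr => i _; ring.
  have cr : forall i : 'I_k, c (rshift m i) = 0.
    apply: (fe (fun i => c (rshift m i))).
    exists s, (mu - s * B), be; split=> //.
    have -> : s * Y = s * (X + Y) - s * X by ring.
    by rewrite eq1 XB; ring.
  have Y0 : Y = 0 by rewrite /Y big1 // => i _; rewrite cr mul0r.
  (* Regularity of [p] modulo [q] strips [p] from a relation among the [p * b i]. *)
  have /reg [s' [g [us' eg]]] : p * (s * B - mu) = q * be.
    have -> : p * (s * B - mu) = s * (X + Y) - p * mu by rewrite Y0 XB; ring.
    by rewrite eq1; ring.
  have MB : M B.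
    apply: (MP (s' * s)); first exact: unit_atM.
    have -> : s' * s * B = g * q + s' * mu.
      by rewrite [g * q]mulrC -eg; ring.
    by apply: MD; apply: MM.
  have cl := fb _ MB.
  by move=> i; rewrite -(fintype.splitK i); case: (fintype.split i) => j /=; rewrite ?cl ?cr.
have {}fE : lin_free (N u) E.
  apply: lin_free_sub fE => h [s [mu [be [us Mmu eq1]]]].
  have [s' [m' [b' [us' Mm' eq2]]]] := Mu Mmu.
  exists (s' * s), m', (b' + s' * be); split=> //; first exact: unit_atM.
  by rewrite -mulrA eq1 mulrDr eq2; ring.
(* Giving up [m] of the [m + k] vectors pays for adjoining the [u * b i]; the enlarged space
   contains the whole trace of [(u, q)]. *)
have [e' fe'] := lin_free_quotient (fun i => u * b i) (N_lin u) fE.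
exists e'; apply: lin_free_sub fe' => h [s [al [be [us eq1]]]].
(* The coefficient of [u] is the fraction [al / s]; modulo [M] it becomes the polynomial [s' * al],
   which the basis [b] expands. *)
have [s' Ms'] := Minv us.
have [d Md] := spb (s' * al).
exists d; set mu := s' * al - _ in Md.
exists s, (al * (1 - s * s') + s * mu), be; split=> //.
  by apply: MD; apply: MM.
have -> : \sum_(i < m) (d i)%:K * (u * b i) = u * (s' * al - mu).
  by rewrite /mu opprB addrC subrK mulr_sumr; apply: eq_bigr => i _; ring.
by rewrite mulrBr eq1; ring.
Qed.

End Comparison.

End LocalIdeals.

(** * Ideals of finite colength, integral dependence and reductions *)

Section Reduction.
Variables (K : fieldType) (z : K * K).
Local Notation Rg := {poly {poly K}}.
Local Notation "c %:K" := (c%:P%:P : Rg) (at level 1, format "c %:K").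
Local Notation t1 := ('X - (z.1)%:K : Rg).
Local Notation t2 := (('X - (z.2)%:P)%:P : Rg).
Implicit Types (a b g h m p q s u : Rg) (M : Rg -> Prop).

Lemma vanish_at h : h.[z.1, z.2] = 0 -> exists a b, h = a * t1 + b * t2.
Proof.
move=> hz.
have /factor_theorem [b eb] : root h.[z.1%:P] z.2 by apply/eqP.
have /factor_theorem [a ea] : root (h - (h.[z.1%:P])%:P) z.1%:P.
  by rewrite /root hornerD hornerN hornerC subrr.
exists a, b%:P; rewrite -ea -polyCM -eb; ring.
Qed.

Lemma nilpotent_at M A B a b :
  sat_ideal z M -> M (t1 ^+ B) -> M (t2 ^+ A) -> M ((a * t1 + b * t2) ^+ (B + A)).
Proof.
move=> [M0 MD MM _] M1 M2; rewrite exprDn.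
elim/big_ind: _ => // i _.
rewrite -mulr_natl; apply: (MM _ (_ * _)); rewrite !exprMn.
have [iA|iA] := leqP A i.
  have -> : t2 ^+ i = t2 ^+ (i - A) * t2 ^+ A by rewrite -exprD subnK.
  by rewrite !mulrA; apply: MM.
have iB : (B <= B + A - i)%N by rewrite -addnBA ?leq_addr // ltnW.
have -> : t1 ^+ (B + A - i) = t1 ^+ (B + A - i - B) * t1 ^+ B by rewrite -exprD subnK.
by rewrite mulrC !mulrA; apply: MM.
Qed.

(** Scaled to value 1 at [z], [s] differs from 1 by an element nilpotent modulo [M]: the geometric
    series stops. *)
Lemma unit_at_inv M A B s :
  sat_ideal z M -> M (t1 ^+ B) -> M (t2 ^+ A) -> unit_at z s ->
  exists s', M (1 - s * s').
Proof.
move=> Mi M1 M2 us; pose c := (s.[z.1, z.2])^-1.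
have [a [b e]] : exists a b, 1 - c%:K * s = a * t1 + b * t2.
  apply: vanish_at; rewrite !hornerE /c mulVf ?subrr //; exact: us.
have pw k : exists s', (1 - c%:K * s) ^+ k = 1 - s * s'.
  elim: k => [|k [s' e']]; first by exists 0; rewrite mulr0 subr0.
  by exists (c%:K + s' - c%:K * s * s'); rewrite exprS e'; ring.
have [s' e'] := pw (B + A)%N.
by exists s'; rewrite -e' e; exact: nilpotent_at.
Qed.

(** Division by [t1 ^+ B] in z_1, then of each coefficient by the power [A] of z_2 minus [z.2],
    leaves [A * B] monomials. *)
Lemma span_at M A B :
  sat_ideal z M -> M (t1 ^+ B) -> M (t2 ^+ A) ->
  exists n (w : 'I_n -> Rg), forall h, add_span M w h.
Proof.
move=> [M0 MD MM _] M1 M2.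
pose w (ij : 'I_B * 'I_A) : Rg := ('X^(ij.2))%:P * 'X^(ij.1).
exists #|{: 'I_B * 'I_A}|, (fun i => w (enum_val i)) => h.
have mon : t1 ^+ B \is monic by rewrite monic_exp // monicXsubC.
pose r := Pdiv.Ring.rmodp h (t1 ^+ B); pose c := ('X - (z.2)%:P) ^+ A : {poly K}.
exists (fun i : 'I_#|{: 'I_B * 'I_A}| => (r`_(enum_val i).1 %% c)`_(enum_val i).2).
rewrite -(@big_enum_val _ _ _ _ (mem {: 'I_B * 'I_A})
  (fun ij => (((r`_ij.1 %% c)`_ij.2)%:K * w ij))) /=.
have -> : \sum_(ij in {: 'I_B * 'I_A}) ((r`_ij.1 %% c)`_ij.2)%:K * w ij =
   \sum_(i < B) \sum_(j < A) ((r`_i %% c)`_j)%:K * (('X^j)%:P * 'X^i).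
  by rewrite pair_bigA; apply: eq_bigl => -[i j]; rewrite inE.
have sc : size c = A.+1.
  by rewrite /c size_exp_XsubC.
have sr : (size r <= B)%N.
  rewrite -ltnS (leq_trans (Pdiv.Ring.ltn_rmodpN0 _ (monic_neq0 mon))) //.
  by rewrite size_exp_XsubC.
have -> : h = Pdiv.Ring.rdivp h (t1 ^+ B) * t1 ^+ B + r by exact: Pdiv.RingMonic.rdivp_eq.
rewrite -addrA; apply: (MD _ _ (MM _ _ M1)).
have er : r = \sum_(i < B) r`_i *: 'X^i.
  rewrite -[LHS]coefK poly_def (big_ord_widen B (fun i => r`_i *: 'X^i) sr).
  rewrite [RHS](bigID (fun i : 'I_B => (i < size r)%N)) /= [X in _ + X]big1 ?addr0 //.
  by move=> i; rewrite -leqNgt => le; rewrite nth_default // scale0r.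
rewrite [X in M (X - _)]er.
rewrite -sumrB; apply: (big_ind M) => // i _.
have -> : \sum_(j < A) ((r`_i %% c)`_j)%:K * (('X^j)%:P * 'X^i) =
    (r`_i %% c)%:P * 'X^i.
  have sm : (size (r`_i %% c)%R <= A)%N by rewrite -ltnS -sc ltn_modp -size_poly_gt0 sc.
  transitivity ((\sum_(j < A) (r`_i %% c)`_j *: 'X^j)%:P * 'X^i : Rg).
    rewrite rmorph_sum mulr_suml; apply: eq_bigr => j _ /=.
    by rewrite -mul_polyC polyCM mulrA.
  congr (_%:P * _); rewrite -[RHS]coefK poly_def.
  rewrite (big_ord_widen A (fun j => (r`_i %% c)`_j *: 'X^j) sm).
  rewrite [LHS](bigID (fun j : 'I_A => (j < size (r`_i %% c)%R)%N)) /=.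
  rewrite [X in _ + X]big1 ?addr0 //.
  by move=> j; rewrite -leqNgt => le; rewrite nth_default // scale0r.
rewrite {1}(divp_eq r`_i c) -mul_polyC polyCD mulrDl addrK polyCM rmorphXn /= mulrAC.
exact: MM.
Qed.

(* [powers p u k] is the [k]-th power of the ideal generated by [p] and [u]. *)
Fixpoint powers p u k h : Prop :=
  if k is k'.+1 then
    exists a b, [/\ powers p u k' a, powers p u k' b & h = p * a + u * b]
  else True.

Lemma powersMl p u k a h : powers p u k h -> powers p u k (a * h).
Proof.
elim: k a h => [//|k IH] a h /= [x [y [hx hy ->]]].
by exists (a * x), (a * y); split; [exact: IH | exact: IH | ring].
Qed.

Lemma powersD p u k g h : powers p u k g -> powers p u k h -> powers p u k (g + h).
Proof.
elim: k g h => [//|k IH] g h /= [x [y [hx hy ->]]] [x' [y' [hx' hy' ->]]].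
by exists (x + x'), (y + y'); split; [exact: IH | exact: IH | ring].
Qed.

Lemma powersMDl p u k l g h :
  powers p u k g -> powers p u l h -> powers p u (k + l) (g * h).
Proof.
elim: k g => [|k IH] g; first by move=> _; exact: powersMl.
move=> [x [y [hx hy ->]]] hh; exists (x * h), (y * h).
by split; [exact: IH | exact: IH | ring].
Qed.

Lemma powersN p u k h : powers p u k h -> powers p u k (- h).
Proof. by rewrite -mulN1r; exact: powersMl. Qed.

Lemma powersXl p u k : powers p u k (p ^+ k).
Proof.
elim: k => [//|k IH] /=; exists (p ^+ k), 0; split=> //.
  by rewrite -(mul0r (p ^+ k)); exact: powersMl.
by rewrite exprS; ring.
Qed.

Lemma powersXr p u k : powers p u k (u ^+ k).
Proof.
elim: k => [//|k IH] /=; exists 0, (u ^+ k); split=> //.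
  by rewrite -(mul0r (u ^+ k)); exact: powersMl.
by rewrite exprS; ring.
Qed.

(** Every product of [k.+1] factors [p] and [u], except the pure power of [u], contains a factor
    [p]. *)
Lemma powers_mulr p u k m : powers p u k m ->
  exists a c, powers p u k a /\ u * m = p * a + u ^+ k.+1 * c.
Proof.
elim: k m => [m _|k IH m [x [y [hx hy ->]]]]; first by exists 0, m; split=> //; ring.
have [a [c [ha e]]] := IH y hy.
exists (u * x + u * a), c; split; last first.
  have -> : u * (p * x + u * y) = p * (u * x) + u * (u * y) by ring.
  by rewrite e [u ^+ k.+2]exprS; ring.
by exists 0, (x + a); split; [rewrite -(mul0r x); exact: powersMl | exact: powersD | ring].
Qed.

(* [u] is integral over the ideal [p] in the local ring modulo [q]. *)
Definition integral_over p u q := exists k s m b,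
  [/\ unit_at z s, powers p u k m & s * u ^+ k.+1 = p * m + q * b].

(** The product of the two equations, each solved for its multiple of [q] or [q'], is again such an
    equation. This allows [q] to be treated factor by factor. *)
Lemma integral_overM p u q q' :
  integral_over p u q -> integral_over p u q' -> integral_over p u (q * q').
Proof.
move=> [k [s [m [b [us hm e]]]]] [k' [s' [m' [b' [us' hm' e']]]]].
exists (k + k'.+1)%N, (s * s'),
  (m * (s' * u ^+ k'.+1) + s * u ^+ k.+1 * m' - p * (m * m')), (b * b').
split; first exact: unit_atM.
  apply: powersD; first apply: powersD.
  - by apply: powersMDl => //; apply: powersMl; exact: powersXr.
  - rewrite addnS -addSn; apply: powersMDl => //; apply: powersMl; exact: powersXr.
  - apply: powersN; rewrite addnS; exists (m * m'), 0.
    split; [exact: powersMDl | | ring].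
    by rewrite -(mul0r (m * m')); apply: powersMl; exact: powersMDl.
have -> : s * s' * u ^+ (k + k'.+1).+1 = (s * u ^+ k.+1) * (s' * u ^+ k'.+1).
  by rewrite -addSn exprD; ring.
have -> : q * q' * (b * b') = (q * b) * (q' * b') by ring.
have -> : q * b = s * u ^+ k.+1 - p * m by rewrite e; ring.
have -> : q' * b' = s' * u ^+ k'.+1 - p * m' by rewrite e'; ring.
by ring.
Qed.

Lemma loc_idealX p q h k :
  loc_ideal z p q h -> loc_ideal z (p ^+ k) q (h ^+ k).
Proof.
move=> [s [a [b [us e]]]]; exists (s ^+ k), (a ^+ k).
suff [c ec] : exists c, (s * h) ^+ k = a ^+ k * p ^+ k + c * q.
  by exists c; split; [exact: unit_atX | rewrite -exprMn].
rewrite e; elim: k => [|k [c ec]]; first by exists 0; rewrite !expr0; ring.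
exists (b * (a ^+ k * p ^+ k) + (a * p + b * q) * c).
by rewrite exprS ec !exprS; ring.
Qed.

(* Modulo [q], the ideal [(p)] is a reduction of [(p, u)]: for large [k], the
   [k]-th power [M] of [(p, u)] satisfies [u M <= p M]. *)
Lemma intersection_le p q u A B :
  (forall a b, p * a = q * b -> exists s c, unit_at z s /\ s * a = q * c) ->
  loc_ideal z p q (t1 ^+ B) -> loc_ideal z p q (t2 ^+ A) ->
  integral_over p u q ->
  forall k (e : 'I_k -> Rg), lin_free (loc_ideal z p q) e ->
  exists e' : 'I_k -> Rg, lin_free (loc_ideal z u q) e'.
Proof.
move=> reg i1 i2 [k [s [m [b [us hm e]]]]] j ej fej.
pose M h := exists s' m' b', [/\ unit_at z s', powers p u k m' & s' * h = m' + q * b'].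
have Mi : sat_ideal z M.
  split.
  - exists 1, 0, 0; split; [exact: unit_at1 | | ring].
    by rewrite -(mul0r (p ^+ k)); apply: powersMl; exact: powersXl.
  - move=> g h [s1 [m1 [b1 [u1 h1 e1]]]] [s2 [m2 [b2 [u2 h2 e2]]]].
    exists (s1 * s2), (s2 * m1 + s1 * m2), (s2 * b1 + s1 * b2); split.
    + exact: unit_atM.
    + by apply: powersD; exact: powersMl.
    have -> : s1 * s2 * (g + h) = s2 * (s1 * g) + s1 * (s2 * h) by ring.
    by rewrite e1 e2; ring.
  - move=> c h [s1 [m1 [b1 [u1 h1 e1]]]].
    exists s1, (c * m1), (c * b1); split=> //; first exact: powersMl.
    have -> : s1 * (c * h) = c * (s1 * h) by ring.
    by rewrite e1; ring.
  - move=> t h ut [s1 [m1 [b1 [u1 h1 e1]]]].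
    by exists (s1 * t), m1, b1; split=> //; [exact: unit_atM | rewrite -mulrA].
have Mq : M q.
  exists 1, 0, 1; split; [exact: unit_at1 | | ring].
  by rewrite -(mul0r (p ^+ k)); apply: powersMl; exact: powersXl.
have Mpk h : loc_ideal z (p ^+ k) q h -> M h.
  move=> [s1 [a1 [b1 [u1 e1]]]]; exists s1, (a1 * p ^+ k), b1.
  by split=> //; [apply: powersMl; exact: powersXl | rewrite e1; ring].
have M1 : M (t1 ^+ (B * k)) by rewrite exprM; apply/Mpk/loc_idealX.
have M2 : M (t2 ^+ (A * k)) by rewrite exprM; apply/Mpk/loc_idealX.
have [n [w spw]] := span_at Mi M1 M2.
apply: (lin_free_transfer Mi Mq _ reg _ spw fej); last first.
  by move=> s1 us1; exact: unit_at_inv Mi M1 M2 us1.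
move=> h [s1 [m1 [b1 [u1 h1 e1]]]].
(* Only the term in [u ^+ k.+1] is not yet a multiple of [p]; the integral equation rewrites it. *)
have [a [c [ha ea]]] := powers_mulr h1.
exists (s * s1), (s * a + m * c), (u * b1 * s + b * c); split.
- exact: unit_atM.
- exists 1, (s * a + m * c), 0; split; [exact: unit_at1 | | ring].
  by apply: powersD; [exact: powersMl | rewrite mulrC; exact: powersMl].
have -> : s * s1 * (u * h) = s * u * (s1 * h) by ring.
rewrite e1.
have -> : s * u * (m1 + q * b1) = s * (u * m1) + s * u * q * b1 by ring.
rewrite ea.
have -> : s * (p * a + u ^+ k.+1 * c) = s * p * a + (s * u ^+ k.+1) * c by ring.
by rewrite e; ring.
Qed.

End Reduction.

(** * Coprime bivariate polynomials *)

Section Coprimality.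
Variable K : closedFieldType.
Local Notation Rg := {poly {poly K}}.
Local Notation "c %:K" := (c%:P%:P : Rg) (at level 1, format "c %:K").
Implicit Types (a b g h p q : Rg) (x y : K).

(** Restriction to the line where z_2 is [x]. In values [h.[y, x]], [y] stands for z_1 and [x] for
    z_2. *)
Definition fibre x h : {poly K} := map_poly (horner_eval x) h.

Lemma fibreE x y h : (fibre x h).[y] = h.[y, x].
Proof. by have := horner_map (horner_eval x) h y%:P; rewrite /= /horner_eval hornerC. Qed.

Lemma fibreM x g h : fibre x (g * h) = fibre x g * fibre x h.
Proof. exact: rmorphM. Qed.

Lemma fibreB x g h : fibre x (g - h) = fibre x g - fibre x h.
Proof. exact: rmorphB. Qed.

Lemma fibreC x (c : {poly K}) : fibre x c%:P = (c.[x])%:P.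
Proof. by rewrite /fibre map_polyC. Qed.

Lemma fibre_eq0 x h : fibre x h = 0 -> exists h', h = ('X - x%:P)%:P * h'.
Proof.
move=> h0.
have hi i : root h`_i x.
  have := congr1 (fun P : {poly K} => P`_i) h0.
  by rewrite coef_map coef0 => /eqP.
exists (\poly_(i < size h) (h`_i %/ ('X - x%:P))).
apply/polyP => i; rewrite coefCM coef_poly.
case: ltnP => [_|le]; last by rewrite nth_default // mulr0.
by rewrite mulrC divpK // dvdp_XsubCl.
Qed.

Lemma XsubC_neq0 x : ('X - x%:P)%:P != 0 :> Rg.
Proof. by rewrite polyC_eq0 polyXsubC_eq0. Qed.

Lemma fibre_XsubC x : fibre x ('X - x%:P)%:P = 0.
Proof. by rewrite fibreC !hornerE subrr. Qed.

Lemma fibre_cancel x A g a b : fibre x g != 0 ->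
  g * b = ('X - x%:P)%:P ^+ A * a -> exists b', b = ('X - x%:P)%:P ^+ A * b'.
Proof.
move=> g0; elim: A a b => [|A IH] a b e; first by exists b; rewrite expr0 mul1r.
have /fibre_eq0 [b' eb] : fibre x b = 0.
  have := congr1 (fibre x) e.
  rewrite exprS -mulrA !fibreM fibre_XsubC mul0r => /eqP.
  by rewrite mulf_eq0 (negPf g0) => /eqP.
have [b'' eb''] : exists b'', b' = ('X - x%:P)%:P ^+ A * b''.
  apply: (IH a); apply: (mulfI (XsubC_neq0 x)).
  by rewrite [RHS]mulrA -exprS -e eb; ring.
by exists b''; rewrite eb eb'' exprS mulrA.
Qed.

Lemma fibre_split x g : g != 0 ->
  exists k g', g = ('X - x%:P)%:P ^+ k * g' /\ fibre x g' != 0.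
Proof.
have [n] := ubnP (size (lead_coef g)); elim: n g => // n IH g lt g0.
have [/fibre_eq0 [h eh]|fg] := eqVneq (fibre x g) 0; last first.
  by exists 0%N, g; rewrite expr0 mul1r.
have h0 : h != 0 by apply: contra_neq g0 => h0; rewrite eh h0 mulr0.
have [||k [g' [eg fg']]] := IH h => //.
  rewrite (leq_trans _ (ltnSE lt)) // eh lead_coefM lead_coefC.
  by rewrite size_monicM ?monicXsubC ?lead_coef_eq0 // size_XsubC.
by exists k.+1, g'; split=> //; rewrite exprS -mulrA -eg.
Qed.

Lemma primitive_part g : g != 0 ->
  exists c g', [/\ c != 0, g = c%:P * g' & forall x, fibre x g' != 0].
Proof.
have [n] := ubnP (size (lead_coef g)); elim: n g => // n IH g lt g0.
have [[x fx]|nx] := pselect (exists x, fibre x g = 0); last first.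
  exists 1, g; split; rewrite ?oner_eq0 ?mul1r // => x.
  by apply/eqP => fx; case: nx; exists x.
have [h eh] := fibre_eq0 fx.
have h0 : h != 0 by apply: contra_neq g0 => h0; rewrite eh h0 mulr0.
have [||c [g' [c0 eg fg']]] := IH h => //.
  rewrite (leq_trans _ (ltnSE lt)) // eh lead_coefM lead_coefC.
  by rewrite size_monicM ?monicXsubC ?lead_coef_eq0 // size_XsubC.
exists (('X - x%:P) * c), g'; split=> //.
  by rewrite mulf_neq0 ?polyXsubC_eq0.
by rewrite polyCM -mulrA -eg.
Qed.

(** Gauss's lemma: the field being algebraically closed, the denominator [c] is removed root by
    root. *)
Lemma gauss_dvd g a p (c : {poly K}) : (forall x, fibre x g != 0) -> c != 0 ->
  c%:P * p = a * g -> exists a', p = a' * g.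
Proof.
move=> fg; have [n] := ubnP (size c); elim: n c a => // n IH c a lt c0 e.
have [sc|sc] := boolP (size c == 1).
  have /size_poly1P [d d0 ed] := sc.
  exists ((d^-1)%:K * a); rewrite -mulrA -e ed mulrA -!rmorphM mulVf //=.
  by rewrite mul1r.
have [x /factor_theorem [c' ec]] := closed_rootP _ sc.
have [b eb] : exists b, a = ('X - x%:P)%:P ^+ 1 * b.
  by apply: (fibre_cancel (fg x) (a := c'%:P * p)); rewrite mulrC -e ec polyCM; ring.
have c'0 : c' != 0 by apply: contra_neq c0 => c'0; rewrite ec c'0 mul0r.
apply: (IH c' b) => //.
  by rewrite (leq_trans _ (ltnSE lt)) // ec size_Mmonic ?monicXsubC // size_XsubC addn2.
apply: (mulfI (XsubC_neq0 x)).
have -> : ('X - x%:P)%:P * (b * g) = ('X - x%:P)%:P ^+ 1 * b * g by rewrite expr1 mulrA.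
by rewrite -eb -e ec polyCM; ring.
Qed.

Definition coprime2 p q :=
  forall d a b, p = a * d -> q = b * d -> exists c : K, d = c%:K.

(** The eliminant is the resultant: were it zero, the primitive part of the gcd in z_1 would be a
    nonconstant common factor. A polynomial free of z_1 is its own eliminant. *)
Lemma coprime2_elim p q : p != 0 -> q != 0 -> coprime2 p q ->
  exists (r : {poly K}) a b, r != 0 /\ r%:P = a * p + b * q.
Proof.
move=> p0 q0 co.
have [sp|sp] := leqP (size p) 1.
  exists p`_0, 1, 0; rewrite mul1r mul0r addr0 -(size1_polyC sp).
  by split=> //; rewrite -polyC_eq0 -(size1_polyC sp).
have [sq|sq] := leqP (size q) 1.
  exists q`_0, 0, 1; rewrite mul1r mul0r add0r -(size1_polyC sq).
  by split=> //; rewrite -polyC_eq0 -(size1_polyC sq).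
have [[a b] _ e] := resultant_in_ideal sp sq.
exists (resultant p q), a, b; split=> //.
rewrite resultant_eq0 -leqNgt leqNgt; apply/negP => sg.
have g0 : gcdp p q != 0 by rewrite -size_poly_gt0 (leq_trans _ sg).
have [c [g [c0 eg fg]]] := primitive_part g0.
have dv h : gcdp p q %| h -> exists a', h = a' * g.
  move=> /Pdiv.Idomain.dvdpP [[d1 d2] /= d0 ed].
  apply: (gauss_dvd (a := d2 * c%:P) fg d0).
  by rewrite mul_polyC ed eg mulrA.
have [a' ea'] := dv _ (dvdp_gcdl p q).
have [b' eb'] := dv _ (dvdp_gcdr p q).
have [k ek] := co _ _ _ ea' eb'.
by move: sg; rewrite eg ek -polyCM ltnNge size_polyC_leq1.
Qed.

Section AtPoint.
Variables (z : K * K) (p q : Rg).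
Hypotheses (p0 : p != 0) (q0 : q != 0) (co : coprime2 p q).
Local Notation t1 := ('X - (z.1)%:K : Rg).
Local Notation t2 := (('X - (z.2)%:P)%:P : Rg).

Lemma coprime2_fibre : fibre z.2 q = 0 -> fibre z.2 p != 0.
Proof.
move=> /fibre_eq0 [b eb]; apply/eqP => /fibre_eq0 [a ea].
have [||c] := co (d := t2) (a := a) (b := b); rewrite 1?[RHS]mulrC //.
move=> /polyC_inj /(congr1 (fun P : {poly K} => size P)).
by rewrite size_XsubC => e; have := size_polyC_leq1 c; rewrite -e.
Qed.

Lemma loc_ideal_t2 : exists A, loc_ideal z p q (t2 ^+ A).
Proof.
have [r [a [b [r0 e]]]] := coprime2_elim p0 q0 co.
have [A [r' /implyP /(_ r0) nr er]] := multiplicity_XsubC r z.2.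
exists A, r'%:P, a, b; split; last by rewrite -e er polyCM rmorphXn.
by rewrite /unit_at hornerC.
Qed.

Lemma unit_at_map_polyC (w : {poly K}) : unit_at z (map_poly polyC w) = (w.[z.1] != 0).
Proof. by rewrite /unit_at horner_map hornerC. Qed.

Lemma fibre_lift x h : exists b, h = map_poly polyC (fibre x h) + ('X - x%:P)%:P * b.
Proof.
have /fibre_eq0 [b eb] : fibre x (h - map_poly polyC (fibre x h)) = 0.
  rewrite /fibre rmorphB /= -map_poly_comp.
  rewrite (eq_map_poly (g := id)) ?map_poly_id ?subrr // => c /=.
  by rewrite /horner_eval hornerC.
by exists b; rewrite -eb addrC subrK.
Qed.

(** One of [p], [q] does not vanish on the line through [z]; modulo it, a unit times a power of [t1]
    is a multiple of [t2], and a power of [t2] is already in the ideal. *)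
Lemma loc_ideal_t1 : exists B, loc_ideal z p q (t1 ^+ B).
Proof.
have [A hA] := loc_ideal_t2.
have Ii := loc_ideal_sat z p q; have [I0 ID IM IP] := Ii.
suff main h : loc_ideal z p q h -> fibre z.2 h != 0 ->
    exists B, loc_ideal z p q (t1 ^+ B).
  have [/coprime2_fibre fp|fq] := eqVneq (fibre z.2 q) 0.
    by apply: main fp; exact: loc_ideall.
  by apply: main fq; exact: loc_idealr.
move=> hI fh.
have [B [w /implyP /(_ fh) nw ew]] := multiplicity_XsubC (fibre z.2 h) z.1.
have [b eb] := fibre_lift z.2 h.
have e1 : map_poly polyC w * t1 ^+ B = h - t2 * b.
  rewrite [in RHS]eb addrK ew rmorphM rmorphXn /=.
  by rewrite rmorphB /= map_polyX map_polyC.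
exists (B * A)%N; apply: (IP (map_poly polyC w ^+ A)).
  by apply: unit_atX; rewrite unit_at_map_polyC.
rewrite exprM -exprMn e1.
have [c ec] : exists c, (h - t2 * b) ^+ A = (- b) ^+ A * t2 ^+ A + c * h.
  elim: (A) => [|k [c ec]]; first by exists 0; rewrite !expr0; ring.
  exists ((- b) ^+ k * t2 ^+ k + (h - t2 * b) * c).
  by rewrite exprS ec !exprS; ring.
by rewrite ec; apply: ID; exact: IM.
Qed.

(** A power of [t2] times a unit lies in [(p, q)], so the claim holds after multiplication by
    [t2 ^+ A], which cancels once [q] has no factor [t2]. If it has one, [p] has none, and the
    factors pass to [a]. *)
Lemma coprime2_regular a b : p * a = q * b ->
  exists s c, unit_at z s /\ s * a = q * c.
Proof.
have [A [s [al [be [us es]]]]] := loc_ideal_t2.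
have tA0 : t2 ^+ A != 0 by rewrite expf_neq0 // XsubC_neq0.
move=> e.
have [fq|fq] := eqVneq (fibre z.2 q) 0; last first.
  have e1 : q * (al * b + be * a) = t2 ^+ A * (s * a).
    have -> : t2 ^+ A * (s * a) = (s * t2 ^+ A) * a by ring.
    have -> : q * (al * b + be * a) = al * (q * b) + be * q * a by ring.
    by rewrite es -e; ring.
  have [c ec] := fibre_cancel fq e1.
  exists s, c; split=> //; apply: (mulfI tA0).
  by rewrite -e1 ec; ring.
have fp := coprime2_fibre fq.
have [k [q' [eq fq']]] := fibre_split z.2 q0.
have tk0 : t2 ^+ k != 0 by rewrite expf_neq0 // XsubC_neq0.
have e0 : p * a = t2 ^+ k * (q' * b) by rewrite e {1}eq; ring.
have [a' ea] := fibre_cancel fp e0.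
have {}e0 : p * a' = q' * b by apply: (mulfI tk0); rewrite -e0 ea; ring.
have e1 : q' * (al * b + be * t2 ^+ k * a') = t2 ^+ A * (s * a').
  have -> : t2 ^+ A * (s * a') = (s * t2 ^+ A) * a' by ring.
  have -> : q' * (al * b + be * t2 ^+ k * a') = al * (q' * b) + be * (t2 ^+ k * q') * a' by ring.
  by rewrite es -eq -e0; ring.
have [c ec] := fibre_cancel fq' e1.
exists s, c; split=> //.
have -> : s * a = t2 ^+ k * (s * a') by rewrite ea; ring.
have -> : s * a' = q' * c by apply: (mulfI tA0); rewrite -e1 ec; ring.
by rewrite eq; ring.
Qed.

End AtPoint.

End Coprimality.

(** * Integrality from boundedness *)

Section Companion.

(** The first unit row vector is cyclic for the companion matrix, so a relation of degree at most
    [d] can be read off on it. *)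
Lemma companion_exists (A : comNzRingType) (d : nat) (h : {poly A}) :
  h \is monic -> size h = d.+2 ->
  exists C : 'M[A]_d.+1, char_poly C = h /\
    forall r : {poly A}, (size r <= d.+1)%N -> horner_mx C r = 0 -> r = 0.
Proof.
move=> mh sh; have e : (size h).-1 = d.+1 by rewrite sh.
pose C : 'M[A]_d.+1 := castmx (e, e) (companionmx h).
have charC : char_poly C = h.
  rewrite -[RHS](companionmxK mh) /C.
  by move: (companionmx h); clear C; case: _ / e.
exists C; split=> // r sr r0.
have CE (i j : 'I_d.+1) : C i j = if i == d :> nat then - h`_j else (i.+1 == j :> nat)%:R.
  by rewrite /C castmxE mxE /= !sh.
have row0 (i : 'I_d.+1) : delta_mx 0 0 *m C ^+ i = delta_mx 0 i :> 'rV_d.+1.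
  case: i => i lt; elim: i lt => [|i IH] lt.
    by rewrite expr0 mulmx1; congr delta_mx; apply: val_inj.
  rewrite exprSr mulmxA (IH (ltnW lt)).
  apply/rowP => j; rewrite -rowE !mxE CE /=.
  by rewrite ltn_eqF //= eq_sym.
have : delta_mx 0 0 *m horner_mx C r = 0 :> 'rV_d.+1 by rewrite r0 mulmx0.
rewrite -[r]coefK poly_def.
rewrite (_ : \sum_(i < size r) r`_i *: 'X^i = \sum_(i < d.+1) r`_i *: 'X^i); last first.
  rewrite (big_ord_widen d.+1 (fun i => r`_i *: 'X^i) sr).
  rewrite [RHS](bigID (fun i : 'I_d.+1 => (i < size r)%N)) /= [X in _ + X]big1 ?addr0 //.
  by move=> i; rewrite -leqNgt => le; rewrite nth_default // scale0r.
rewrite linear_sum mulmx_sumr => e0.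
rewrite big1 // => i _.
have := congr1 (fun M : 'rV[A]_d.+1 => M 0 i) e0.
rewrite summxE [RHS]mxE (bigD1 i) //= big1 ?addr0 => [|j ji].
  rewrite linearZ rmorphXn /= horner_mx_X -scalemxAr row0 !mxE !eqxx mulr1 => ->.
  by rewrite scale0r.
rewrite linearZ rmorphXn /= horner_mx_X -scalemxAr row0 !mxE !eqxx /=.
by rewrite eq_sym (negPf ji) mulr0.
Qed.

(** A Bezout identity between [h] and the characteristic polynomial would make [h(C)] invertible, by
    Cayley-Hamilton. *)
Lemma det_horner_mx_eq0 (K : closedFieldType) (d : nat) (C : 'M[K]_d.+1) (h : {poly K}) :
  \det (horner_mx C h) = 0 ->
  exists y, root (char_poly C) y /\ root h y.
Proof.
move=> det0; have [co|nco] := boolP (coprimep h (char_poly C)); last first.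
  have [y] := closed_rootP _ nco.
  by rewrite root_gcd => /andP [hy cy]; exists y.
have /Bezout_coprimepP [[a b] /= /eqpP [[c1 c2] /= /andP [c10 c20] e]] := co.
have : horner_mx C (c1 *: (a * h + b * char_poly C)) = horner_mx C (c2 *: 1) by rewrite e.
rewrite !linearZ /= rmorphD !rmorphM /= Cayley_Hamilton mulr0 addr0 rmorph1.
move=> /(congr1 determinant); rewrite !detZ det_mulmx det0 mulr0 mulr0 det1 mulr1.
by move=> /esym/eqP; rewrite expf_eq0 (negPf c20) andbF.
Qed.

(** The power of 2 is a crude bound for the binomial coefficient counting the terms. *)
Lemma coef_prod_XsubC_le (K : numDomainType) (rho : K) (s : seq K) (i : nat) :
  0 <= rho -> (forall x, x \in s -> `|x| <= rho) ->
  `|(\prod_(x <- s) ('X - x%:P))`_i| <= 2 ^+ size s * rho ^+ (size s - i).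
Proof.
move=> rho0; elim: s i => [|x s IH] i hs.
  rewrite big_nil coef1 sub0n !expr0 mul1r.
  by case: (i == 0%N); rewrite ?normr1 ?normr0.
have hs' : forall y, y \in s -> `|y| <= rho by move=> y ys; rewrite hs // inE ys orbT.
rewrite big_cons mulrBl coefB coefXM coefCM /=.
have hx : `|x| <= rho by rewrite hs // mem_head.
have le2 (j : nat) : 0 <= 2 ^+ size s * rho ^+ j by rewrite mulr_ge0 ?exprn_ge0.
apply: (le_trans (ler_normB _ _)); rewrite normrM exprS -mulrA mulr2n mulrDl !mul1r.
apply: lerD.
  case: i => [|i]; first by rewrite normr0.
  by rewrite subSS /=; exact: IH.
have [iS|iS] := leqP i (size s).
  rewrite subSn // exprS mulrCA; apply: ler_pM => //.
  exact: IH.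
rewrite nth_default ?normr0 ?mulr0 //.
by rewrite (size_prod_XsubC s id) /=.
Qed.

End Companion.

(** * Making [q] monic in z_1 by rescaling z_1 with its leading coefficient *)

Section Homogenize.
Variable A : comNzRingType.
Implicit Types (l : A) (h : {poly A}).

(* [l ^+ m * h(Y / l)] *)
Definition scale_up l (m : nat) h : {poly A} := \poly_(i < m.+1) (h`_i * l ^+ (m - i)).

Lemma scale_upE l m h : (size h <= m.+1)%N ->
  scale_up l m h \Po (l *: 'X) = l ^+ m *: h.
Proof.
move=> sh; rewrite /scale_up poly_def rmorph_sum /=.
rewrite -[h in RHS]coefK poly_def.
rewrite (_ : \sum_(i < size h) h`_i *: 'X^i = \sum_(i < m.+1) h`_i *: 'X^i); last first.
  rewrite (big_ord_widen m.+1 (fun i => h`_i *: 'X^i) sh).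
  rewrite [RHS](bigID (fun i : 'I_m.+1 => (i < size h)%N)) /= [X in _ + X]big1 ?addr0 //.
  by move=> i; rewrite -leqNgt => le; rewrite nth_default // scale0r.
rewrite scaler_sumr; apply: eq_bigr => i _.
rewrite comp_polyZ comp_Xn_poly exprZn !scalerA; congr (_ *: _).
by rewrite [RHS]mulrC -mulrA -exprD subnK // -ltnS.
Qed.

(* [l ^+ d * h(Y / l)] for [h] of degree [d.+1] and leading coefficient [l] *)
Definition monic_up (d : nat) h : {poly A} :=
  'X^(d.+1) + \poly_(i < d.+1) (h`_i * lead_coef h ^+ (d - i)).

Lemma monic_upE d h : size h = d.+2 ->
  monic_up d h \Po (lead_coef h *: 'X) = lead_coef h ^+ d *: h.
Proof.
move=> sh; have el : lead_coef h = h`_d.+1 by rewrite lead_coefE sh.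
rewrite /monic_up; move: (lead_coef h) el => l el.
rewrite rmorphD /= comp_Xn_poly exprZn.
rewrite poly_def rmorph_sum /=.
rewrite -[h in RHS]coefK poly_def sh [in RHS]big_ord_recr /= scalerDr addrC; congr (_ + _).
  rewrite scaler_sumr; apply: eq_bigr => i _.
  rewrite comp_polyZ comp_Xn_poly exprZn !scalerA; congr (_ *: _).
  by rewrite [RHS]mulrC -mulrA -exprD subnK // -ltnS.
by rewrite scalerA exprSr el.
Qed.

Lemma size_monic_up d h : size (monic_up d h) = d.+2.
Proof. by rewrite /monic_up size_polyDl size_polyXn // ltnS size_poly. Qed.

Lemma monic_up_monic d h : monic_up d h \is monic.
Proof.
by rewrite monicE /monic_up lead_coefDl ?lead_coefXn // size_polyXn ltnS size_poly.
Qed.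

End Homogenize.

Lemma common_multiplier (A : idomainType) (P : A -> Prop) (a b : nat -> A) (n : nat) :
  P 1 -> (forall x y, P x -> P y -> P (x * y)) ->
  (forall i, exists e c, P e /\ e * a i = c * b i) ->
  exists e c, P e /\ forall i, (i < n)%N -> e * a i = c i * b i.
Proof.
move=> P1 PM H; elim: n => [|n [e [c [Pe IH]]]]; first by exists 1, (fun=> 0).
have [e' [c' [Pe' e1]]] := H n.
exists (e' * e), (fun i => if i == n then e * c' else e' * c i); split; first exact: PM.
move=> i; rewrite ltnS leq_eqVlt => /orP [/eqP ->|lt].
  by rewrite eqxx -mulrA mulrCA e1 mulrA.
by rewrite ltn_eqF // -mulrA IH // mulrA.
Qed.

Section CharacteristicPolynomial.
Variables (A : idomainType) (d : nat) (P U : 'M[A]_d.+1).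
Local Notation delta := (\det P).
Local Notation W := (\adj P *m U).

Hypotheses (comPU : comm_mx P U) (delta0 : delta != 0).

(* Up to the factor [\det P], [W] is the matrix [P^-1 *m U]. *)
Lemma adj_mulmx_exp i : P ^+ i * W ^+ i = delta ^+ i *: U ^+ i.
Proof.
have PW : P * W = delta *: U.
  by rewrite -[LHS]/(P *m W) mulmxA mul_mx_adj mul_scalar_mx.
have cPU k : P ^+ k * U = U * P ^+ k by apply/esym/commrX/esym; exact: comPU.
elim: i => [|i IH]; first by rewrite !expr0 mulr1 scale1r.
rewrite exprSr exprS mulrA -[P ^+ i * P * W]mulrA PW -scalerAr cPU -scalerAl -mulrA IH.
by rewrite -scalerAr scalerA -exprS -exprS.
Qed.

(** The quotients [c i / e] are the coefficients of the characteristic polynomial of [P^-1 *m U];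
    multiplying Cayley-Hamilton for [W] by [P ^+ d.+1] avoids inverting [P]. *)
Lemma homogeneous_Cayley_Hamilton (e : A) (c : nat -> A) :
  (forall i, (i < d.+2)%N ->
     e * (char_poly W)`_i = c i * delta ^+ (d.+1 - i)) ->
  \sum_(i < d.+2) c i *: (P ^+ (d.+1 - i) * U ^+ i) = 0.
Proof.
move=> He.
have CH : \sum_(i < d.+2) (char_poly W)`_i *: W ^+ i = 0.
  rewrite -[RHS](Cayley_Hamilton W) /horner_mx /horner_morph horner_coef.
  rewrite size_map_poly_id0 ?size_char_poly; last first.
    by rewrite (monicP (char_poly_monic _)) rmorph1 oner_neq0.
  by apply: eq_bigr => i _; rewrite coef_map /=; exact: esym (mul_scalar_mx _ _).
pose S' := \sum_(i < d.+2)
  ((char_poly W)`_i * delta ^+ i) *: (P ^+ (d.+1 - i) * U ^+ i).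
have {}CH : S' = 0.
  transitivity (P ^+ d.+1 * \sum_(i < d.+2) (char_poly W)`_i *: W ^+ i).
    rewrite mulr_sumr; apply: eq_bigr => i _.
    have -> : P ^+ d.+1 = P ^+ (d.+1 - i) * P ^+ i by rewrite -exprD subnK // -ltnS.
    by rewrite -scalerA -[RHS]scalerAr -mulrA adj_mulmx_exp -!scalerAr.
  by rewrite CH mulr0.
apply/matrixP => x y; rewrite [RHS]mxE.
set S := \sum_(i < _) _.
have : delta ^+ d.+1 *: S = 0.
  transitivity (e *: S'); last by rewrite CH scaler0.
  rewrite !scaler_sumr; apply: eq_bigr => i _.
  have iN : (i <= d.+1)%N by rewrite -ltnS.
  by rewrite !scalerA mulrA He // -mulrA -exprD subnK // mulrC.
move=> /matrixP /(_ x y); rewrite !mxE => /eqP.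
by rewrite mulf_eq0 expf_eq0 (negPf delta0) andbF => /eqP.
Qed.

End CharacteristicPolynomial.

Section CompanionIntegral.
Variables (K : numClosedFieldType) (z : K * K).
Local Notation Rg := {poly {poly K}}.
Local Notation "c %:K" := (c%:P%:P : Rg) (at level 1, format "c %:K").
Local Notation t2 := (('X - (z.2)%:P)%:P : Rg).
Implicit Types (p q u h : Rg) (x y : K).

Lemma horner2_comp_scale (l : {poly K}) h x y :
  h.[l.[x] * y, x] = (h \Po (l *: 'X)).[y, x].
Proof.
rewrite horner_comp hornerZ hornerX -fibreE.
rewrite -[RHS]/(horner_eval x h.[l * y%:P]) -horner_map /=.
by rewrite /horner_eval hornerM hornerC.
Qed.

(** The leading coefficient of [q] may vanish at [z.2], but powers of [t2] cancel because [q] is not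
    divisible by [t2]; what remains is a unit. *)
Lemma integral_over_lift p u q (d m : nat) (G : Rg) (c : nat -> {poly K}) :
  fibre z.2 q != 0 -> (c d.+1).[z.2] != 0 ->
  (\sum_(i < d.+2) c i *: (p ^+ (d.+1 - i) * u ^+ i)) * (lead_coef q ^+ m)%:P = G * q ->
  integral_over z p u q.
Proof.
move=> fq cz e.
have l0 : lead_coef q != 0.
  by rewrite lead_coef_eq0; apply: contra_neq fq => ->; rewrite /fibre rmorph0.
have [J [l' /implyP /(_ _) nl el]] := multiplicity_XsubC (lead_coef q ^+ m) z.2.
have {}nl : ~~ root l' z.2 by apply: nl; rewrite expf_neq0.
set F := \sum_(i < _) _ in e.
have e1 : q * G = t2 ^+ J * (l'%:P * F).
  by rewrite mulrC -e el polyCM rmorphXn /=; ring.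
have [G' eG] := fibre_cancel fq e1.
have {}e1 : l'%:P * F = q * G'.
  apply: (mulfI (expf_neq0 J (XsubC_neq0 z.2))).
  by rewrite -e1 eG; ring.
pose S := \sum_(i < d.+1) c i *: (p ^+ (d - i) * u ^+ i).
exists d, (l' * c d.+1)%:P, (- l'%:P * S), G'; split.
- by rewrite /unit_at hornerC hornerM mulf_neq0.
- apply: powersMl; rewrite /S; apply: (big_ind (powers p u d)).
  + by rewrite -(mul0r (p ^+ d)); apply: powersMl; exact: powersXl.
  + exact: powersD.
  move=> i _; rewrite -mul_polyC; apply: powersMl.
  have iN : (i <= d)%N by rewrite -ltnS.
  rewrite -[d in powers _ _ d _](subnK iN).
  by apply: powersMDl; [exact: powersXl | exact: powersXr].
have -> : q * G' = l'%:P * (p * S + (c d.+1)%:P * u ^+ d.+1).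
  rewrite -e1 /F big_ord_recr /= subnn expr0 mul1r -mul_polyC; congr (_ * (_ + _)).
  rewrite /S mulr_sumr; apply: eq_bigr => i _.
  by rewrite -scalerAr mulrA -exprS subSn // -ltnS.
by rewrite polyCM; ring.
Qed.

(** [good] is meant as the circle without finitely many points, and the last premise as the absence
    of poles at [z.2] for quotients bounded there. For good [x], generically, the eigenvalues of [W]
    divided by [delta] are values of [u / p] at zeros of [q]. *)
Lemma integral_over_companion p u q (good : K -> Prop) (kb : K) :
  fibre z.2 q != 0 -> 0 <= kb ->
  (forall x y, good x -> q.[y, x] = 0 ->
     p.[y, x] != 0 /\ `|u.[y, x]| <= kb * `|p.[y, x]|) ->
  (forall c : {poly K}, c != 0 -> exists x, good x /\ c.[x] != 0) ->
  (forall (a b c : {poly K}) (k : K), b != 0 -> c != 0 ->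
     (forall x, good x -> c.[x] != 0 -> `|a.[x]| <= k * `|b.[x]|) ->
     exists e c', e.[z.2] != 0 /\ e * a = c' * b) ->
  integral_over z p u q.
Proof.
move=> fq kb0 hgood inf reg.
have [sq|sq] := leqP (size q) 1.
  exists 0%N, q, 0, u; split=> //; last by rewrite mulr0 add0r.
  by move: fq; rewrite (size1_polyC sq) fibreC polyC_eq0 /unit_at hornerC.
have [d sd] : exists d, size q = d.+2.
  by case: (size q) sq => [|[|d]] // _; exists d.
pose l := lead_coef q.
have l0 : l != 0 by rewrite lead_coef_eq0 -size_poly_eq0 sd.
have [C [charC kerC]] := companion_exists (monic_up_monic d q) (size_monic_up d q).
(* A common exponent scales [p] and [u] by the same power of [l], leaving [u / p] unchanged. *)
pose m := maxn (size p) (size u).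
have sp : (size p <= m.+1)%N by rewrite leqW // leq_maxl.
have su : (size u <= m.+1)%N by rewrite leqW // leq_maxr.
pose p' := scale_up l m p; pose u' := scale_up l m u.
pose P := horner_mx C p'; pose U := horner_mx C u'.
have comPU : comm_mx P U by exact: comm_horner_mx2.
have p'E x y : p'.[l.[x] * y, x] = l.[x] ^+ m * p.[y, x].
  by rewrite horner2_comp_scale scale_upE // !hornerZ hornerM ?hornerC horner_exp.
have u'E x y : u'.[l.[x] * y, x] = l.[x] ^+ m * u.[y, x].
  by rewrite horner2_comp_scale scale_upE // !hornerZ hornerM ?hornerC horner_exp.
have common x h : l.[x] != 0 -> (\det (horner_mx C h)).[x] = 0 ->
    exists y, q.[y, x] = 0 /\ h.[l.[x] * y, x] = 0.
  move=> lx det0.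
  have : \det (horner_mx (map_mx (horner_eval x) C) (map_poly (horner_eval x) h)) = 0.
    by rewrite -map_horner_mx det_map_mx.
  move=> /det_horner_mx_eq0 [y' []].
  rewrite -map_char_poly charC /root -!/(fibre _ _) !fibreE => /eqP qy /eqP hy.
  exists (y' / l.[x]); rewrite [l.[x] * _]mulrC divfK //; split=> //.
  move: qy; rewrite -[y' in LHS](divfK lx) [_ / _ * _]mulrC horner2_comp_scale.
  rewrite monic_upE // !hornerZ hornerM ?hornerC horner_exp => /eqP.
  by rewrite mulf_eq0 expf_eq0 (negPf lx) andbF => /eqP.
pose delta := \det P.
have delta0 : delta != 0.
  apply/eqP => d0; have [x [gx lx]] := inf l l0.
  have [|y [qy py]] := common x p' lx; first by rewrite -/delta d0 horner0.
  have [pn _] := hgood _ _ gx qy.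
  by move: py; rewrite p'E => /eqP; rewrite mulf_eq0 expf_eq0 (negPf lx) andbF (negPf pn).
pose W := \adj P *m U.
have rootW x mu : good x -> l.[x] != 0 -> delta.[x] != 0 ->
    root (char_poly (map_mx (horner_eval x) W)) mu -> `|mu| <= kb * `|delta.[x]|.
  move=> gx lx dx; rewrite -eigenvalue_root_char => /eigenvalueP [v vW v0].
  (* An eigenvector of [W] makes this combination singular on the companion matrix, so it vanishes
     at some zero of [q]: there [mu] is [delta] times [u / p]. *)
  pose h := mu%:K * p' - delta%:P * u'.
  have [|y [qy hy]] := common x h lx.
    have -> : horner_mx C h = mu%:P *: P - delta *: U.
      by rewrite /h !mul_polyC linearB !linearZ.
    rewrite -/(horner_eval x _) -det_map_mx; apply/eqP/det0P; exists v => //.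
    rewrite map_mxB !map_mxZ /= {1}/horner_eval hornerC mulmxBr -!scalemxAr.
    have : v *m map_mx (horner_eval x) W *m map_mx (horner_eval x) P =
           mu *: (v *m map_mx (horner_eval x) P) by rewrite vW scalemxAl.
    rewrite -mulmxA -map_mxM -[W *m P]mulmxA -[U *m P]comPU mulmxA mul_adj_mx.
    by rewrite mul_scalar_mx map_mxZ /= -scalemxAr => ->; rewrite subrr.
  have [pn pu] := hgood _ _ gx qy.
  have {}hy : mu * p.[y, x] = delta.[x] * u.[y, x].
    apply: (mulfI (expf_neq0 m lx)); apply/eqP; rewrite -subr_eq0; apply/eqP.
    rewrite -[RHS]hy /h !(hornerD, hornerN, hornerM, hornerC) p'E u'E; ring.
  rewrite -(ler_pM2r (_ : 0 < `|p.[y, x]|)) ?normr_gt0 // -normrM hy normrM.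
  by rewrite [kb * _]mulrC -mulrA ler_wpM2l.
have coefW i : exists e c, e.[z.2] != 0 /\ e * (char_poly W)`_i = c * delta ^+ (d.+1 - i).
  apply: (reg _ _ (l * delta) (2 ^+ d.+1 * kb ^+ (d.+1 - i))).
  - by rewrite expf_neq0.
  - by rewrite mulf_neq0.
  move=> x gx; rewrite hornerM mulf_eq0 negb_or => /andP [lx dx].
  have -> : ((char_poly W)`_i).[x] = (char_poly (map_mx (horner_eval x) W))`_i.
    by rewrite -map_char_poly coef_map.
  have [r er] := closed_field_poly_normal (char_poly (map_mx (horner_eval x) W)).
  move: er; rewrite (monicP (char_poly_monic _)) scale1r => er.
  have sr : size r = d.+1.
    have := size_char_poly (map_mx (horner_eval x) W).
    by rewrite er (size_prod_XsubC r id) => -[].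
  rewrite er horner_exp normrX -mulrA -exprMn -sr.
  apply: coef_prod_XsubC_le; first by rewrite mulr_ge0.
  by move=> mu mur; apply: rootW => //; rewrite er root_prod_XsubC.
have [||e [c [ez ec]]] := common_multiplier (P := fun e : {poly K} => e.[z.2] != 0)
    (a := fun i => (char_poly W)`_i) (b := fun i => delta ^+ (d.+1 - i)) d.+2 _ _ coefW.
- by rewrite hornerC oner_eq0.
- by move=> f g f0 g0; rewrite hornerM mulf_neq0.
have HC := homogeneous_Cayley_Hamilton comPU delta0 ec.
pose G := \sum_(i < d.+2) c i *: (p' ^+ (d.+1 - i) * u' ^+ i).
have kerG : horner_mx C G = 0.
  rewrite -[RHS]HC /G linear_sum; apply: eq_bigr => i _.
  by rewrite linearZ /= rmorphM !rmorphXn.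
have cd : c d.+1 = e.
  have := ec d.+1 (ltnSn _); rewrite subnn expr0 !mulr1 => <-.
  have := monicP (char_poly_monic W); rewrite lead_coefE size_char_poly /= => ->.
  by rewrite mulr1.
(* The remainder has degree at most [d] and is killed by [C], hence is zero. *)
have G_div : G = Pdiv.Ring.rdivp G (monic_up d q) * monic_up d q.
  have eG := Pdiv.RingMonic.rdivp_eq (monic_up_monic d q) G.
  rewrite [LHS]eG [X in _ + X](_ : _ = 0) ?addr0 //; apply: kerC.
    rewrite -ltnS -[d.+2](size_monic_up d q) Pdiv.Ring.ltn_rmodpN0 //.
    by rewrite monic_neq0 // monic_up_monic.
  have kerq : horner_mx C (monic_up d q) = 0 by rewrite -charC Cayley_Hamilton.
  by have := kerG; rewrite [in LHS]eG rmorphD rmorphM /= kerq mulr0 add0r.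
apply: (@integral_over_lift p u q d (m * d.+1)
   (l%:P ^+ d * (Pdiv.Ring.rdivp G (monic_up d q) \Po (l *: 'X))) c) => //.
  by rewrite cd.
have := congr1 (fun h => h \Po (l *: 'X)) G_div.
rewrite /= rmorphM /= monic_upE // => eG.
transitivity (G \Po (l *: 'X)); last first.
  by rewrite eG -(mul_polyC (lead_coef q ^+ d)) rmorphXn /=; ring.
rewrite /G rmorph_sum mulr_suml; apply: eq_bigr => i _ /=.
rewrite comp_polyZ rmorphM !rmorphXn /= !scale_upE // -!mul_polyC !exprMn.
have iN : (i <= d.+1)%N by rewrite -ltnS.
have -> : (l ^+ m)%:P ^+ (d.+1 - i) * p ^+ (d.+1 - i) * ((l ^+ m)%:P ^+ i * u ^+ i) =
   (l ^+ m)%:P ^+ (d.+1 - i) * (l ^+ m)%:P ^+ i * (p ^+ (d.+1 - i) * u ^+ i) by ring.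
rewrite -exprD subnK // -[LHS]mulrA; congr (_ * _).
by rewrite [LHS]mulrC exprM rmorphXn.
Qed.

End CompanionIntegral.

(** * Polynomial inequalities on the circle *)

Section Limits.
Variable K : numClosedFieldType.
Implicit Types (F G : {poly K}) (x y : K).

Lemma le0_small (D M : K) : D \is Num.real -> 0 <= M ->
  (forall e, 0 < e -> e <= 1 -> D <= M * e) -> D <= 0.
Proof.
move=> Dr M0 H; rewrite real_leNgt ?real0 //; apply/negP => D0.
have S0 : 0 < D + M + 1 by rewrite ltr_wpDl // addr_ge0 // ltW.
have : D <= M * (D / (D + M + 1)).
  apply: H; first by rewrite divr_gt0.
  by rewrite ler_pdivrMr // mul1r -addrA lerDl addr_ge0.
rewrite mulrA ler_pdivlMr // [M * D]mulrC ler_pM2l // -subr_ge0.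
have -> : M - (D + M + 1) = - (D + 1) by ring.
by rewrite oppr_ge0 => /(lt_le_trans (ltr_wpDl (ltW D0) ltr01)); rewrite ltxx.
Qed.

Lemma poly_lipschitz F x : exists2 M, 0 <= M &
  forall h, `|h| <= 1 -> `|F.[x + h] - F.[x]| <= M * `|h|.
Proof.
have /factor_theorem [G eG] : root (F \Po ('X + x%:P) - (F.[x])%:P) 0.
  by rewrite /root hornerD hornerN hornerC horner_comp hornerD hornerX hornerC add0r subrr.
exists (\sum_(i < size G) `|G`_i|); first by apply: sumr_ge0.
move=> h h1; have -> : F.[x + h] - F.[x] = G.[h] * h.
  have := congr1 (fun P => P.[h]) eG.
  rewrite /= hornerD hornerN hornerC horner_comp hornerD hornerX hornerC [h + x]addrC => ->.
  by rewrite hornerM hornerXsubC subr0.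
rewrite normrM ler_wpM2r // horner_coef (le_trans (ler_norm_sum _ _ _)) //.
apply: ler_sum => i _; rewrite normrM normrX ler_piMr // exprn_ile1 //.
Qed.

(** Both sides move by at most a multiple of [e]; this replaces every continuity argument for
    polynomials below. *)
Lemma norm_le_limit F G x :
  (forall e, 0 < e -> e <= 1 ->
     exists h, `|h| <= e /\ `|F.[x + h]| <= `|G.[x + h]|) ->
  `|F.[x]| <= `|G.[x]|.
Proof.
move=> H; have [M M0 HM] := poly_lipschitz F x; have [N N0 HN] := poly_lipschitz G x.
rewrite -subr_le0; apply: (@le0_small _ (M + N)) => [||e e0 e1].
- by rewrite rpredB // normr_real.
- by rewrite addr_ge0.
have [h [he hFG]] := H e e0 e1.
have h1 := le_trans he e1.
have {}HM : `|F.[x]| <= `|F.[x + h]| + M * e.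
  rewrite -lerBlDl (le_trans (lerB_dist _ _)) // distrC (le_trans (HM _ h1)) //.
  by rewrite ler_wpM2l.
have {}HN : `|G.[x + h]| <= `|G.[x]| + N * e.
  rewrite -lerBlDl (le_trans (lerB_dist _ _)) // (le_trans (HN _ h1)) //.
  by rewrite ler_wpM2l.
rewrite lerBlDl (le_trans HM) // mulrDl addrA addrAC lerD2r.
exact: le_trans hFG HN.
Qed.

Lemma circle_point x e : `|x| = 1 -> 0 < e -> e <= 1 ->
  exists h, [/\ h != 0, `|h| <= e & `|x + h| = 1].
Proof.
move=> x1 e0 e1; pose s := e / 2.
have sr : s \is Num.real by rewrite ger0_real // divr_ge0 // ltW.
(* The point is [x] rotated by the unimodular number [w^* / w]; the displacement is [e / |w|], at
   most [e] since [|w|] is at least 1. *)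
pose w : K := 1 - 'i * s.
have cw : 1 + 'i * s = w^*.
  by rewrite /w rmorphB rmorph1 rmorphM /= conjCi (CrealP sr) mulNr opprK.
have nw : 1 <= `|w|.
  have e2 : w^* + w = 2 by rewrite -cw /w; ring.
  have : `|w^* + w| <= 2 * `|w|.
    by rewrite (le_trans (ler_normD _ _)) // norm_conjC mulr_natl mulr2n.
  by rewrite e2 normr_nat ler_pMr.
have w0 : w != 0 by rewrite -normr_gt0 (lt_le_trans ltr01).
have nw0 : 0 < `|w| by rewrite normr_gt0.
exists (x * ('i * e / w)); split.
- have xn0 : x != 0 by rewrite -normr_gt0 x1 ltr01.
  have en0 : e != 0 by rewrite gt_eqF.
  by rewrite !mulf_neq0 ?invr_neq0 ?neq0Ci.
- rewrite !normrM normfV x1 normCi !mul1r ler_pdivrMr // gtr0_norm //.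
  by rewrite ler_peMr // ltW.
have -> : x + x * ('i * e / w) = x * (w^* / w).
  rewrite -cw; have -> : 'i * e = 1 + 'i * s - w by rewrite /w /s; field.
  by field.
by rewrite normrM normf_div norm_conjC divff ?normr_eq0 // mulr1.
Qed.

Lemma circle_nonroot F : F != 0 -> exists x, `|x| = 1 /\ F.[x] != 0.
Proof.
move=> F0; have [[x [x1 Fx]]|H] := pselect (exists x, `|x| = 1 /\ F.[x] != 0).
  by exists x.
have {}H x : `|x| = 1 -> F.[x] = 0.
  by move=> x1; apply/eqP/negPn/negP => Fx; case: H; exists x.
have [m [G /implyP /(_ F0) G1 eF]] := multiplicity_XsubC F 1.
suff : `|G.[1]| <= `|(0 : {poly K}).[1]|.
  by rewrite horner0 normr0 normr_le0 => /eqP/rootP; rewrite (negPf G1).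
apply: norm_le_limit => e e0 e1.
have [h [h0 he h1]] := circle_point (normr1 K) e0 e1.
exists h; split=> //; rewrite horner0 normr0 normr_le0.
have := H _ h1; rewrite eF hornerM horner_exp !hornerE addrAC subrr add0r => /eqP.
by rewrite mulf_eq0 expf_eq0 (negPf h0) andbF orbF.
Qed.

(** If [b] vanished at [x0] to higher order than [a], the bound along nearby circle points would
    force the cofactor of [a] to vanish at [x0]. *)
Lemma circle_regular (x0 k : K) (a b c : {poly K}) : `|x0| = 1 -> b != 0 -> c != 0 ->
  (forall x, `|x| = 1 -> c.[x] != 0 -> `|a.[x]| <= k * `|b.[x]|) ->
  exists e c', e.[x0] != 0 /\ e * a = c' * b.
Proof.
move=> x1 b0 c0 H.
have [->|a0] := eqVneq a 0.
  by exists 1, 0; rewrite hornerC oner_eq0 mulr0 mul0r.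
have [al [a1 /implyP /(_ a0) a1x ea]] := multiplicity_XsubC a x0.
have [be [b1 /implyP /(_ b0) b1x eb]] := multiplicity_XsubC b x0.
have [ga [c1 /implyP /(_ c0) c1x ec]] := multiplicity_XsubC c x0.
have [le|lt] := leqP be al.
  exists b1, (a1 * ('X - x0%:P) ^+ (al - be)); split; first exact: b1x.
  by rewrite ea eb -[in LHS](subnK le) exprD; ring.
(* The factor [c1] makes the inequality trivial at the excluded points. *)
suff : `|(c1 * a1).[x0]| <= `|(k%:P * c1 * b1 * ('X - x0%:P) ^+ (be - al)).[x0]|.
  rewrite !hornerM horner_exp !hornerE subrr expr0n subn_eq0 leqNgt lt /= mulr0 normr0.
  by rewrite normr_le0 mulf_eq0 -!rootE (negPf c1x) (negPf a1x).
apply: norm_le_limit => e e0 e1.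
have [h [h0 he h1]] := circle_point x1 e0 e1.
exists h; split=> //; rewrite !hornerM horner_exp !hornerE addrAC subrr add0r.
have [c10|c10] := eqVneq c1.[x0 + h] 0.
  by rewrite c10 mul0r normr0.
have := H _ h1; rewrite ea eb ec !hornerM !horner_exp !hornerE addrAC subrr add0r.
rewrite mulf_neq0 ?expf_neq0 // => /(_ isT).
pose t := `|b1.[x0 + h]| * `|h ^+ (be - al)|.
have -> : h ^+ be = h ^+ (be - al) * h ^+ al by rewrite -exprD subnK // ltnW.
rewrite !normrM !mulrA -[k * _ * _]mulrA -/t ler_pM2r ?normr_gt0 ?expf_neq0 // => le.
have t0 : 0 <= t by rewrite mulr_ge0.
have {}le : `|a1.[x0 + h]| <= `|k| * t.
  by rewrite -[t]ger0_norm // -normrM ger0_norm // (le_trans _ le).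
have -> : `|k| * `|c1.[x0 + h]| * `|b1.[x0 + h]| * `|h ^+ (be - al)| =
  `|c1.[x0 + h]| * (`|k| * t) by rewrite /t; ring.
by rewrite ler_wpM2l.
Qed.

(** Each root is at distance at least [1 - |y|] from [y]. This quantitative form replaces Hurwitz's
    theorem. *)
Lemma horner_lower_bound F y : (forall x, `|x| < 1 -> F.[x] != 0) -> `|y| <= 1 ->
  `|lead_coef F| * (1 - `|y|) ^+ (size F).-1 <= `|F.[y]|.
Proof.
move=> HF y1; have [r er] := closed_field_poly_normal F.
have sr : forall x, x \in r -> 1 <= `|x|.
  move=> x xr; rewrite real_leNgt ?normr_real ?real1 //; apply/negP => /HF.
  by rewrite er hornerZ -[_.[x]]/(_.[x]) (rootP _) ?mulr0 ?eqxx // root_prod_XsubC.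
have [F0|F0] := eqVneq F 0; first by rewrite F0 lead_coef0 normr0 mul0r.
have -> : (size F).-1 = size r.
  by rewrite er size_scale ?lead_coef_eq0 // (size_prod_XsubC r id).
rewrite [X in _ <= `|X.[_]|]er hornerZ normrM ler_wpM2l //.
elim: r sr {er} => [|x r IH] sr; first by rewrite big_nil hornerC normr1 expr0.
rewrite big_cons hornerM normrM exprS ler_pM ?exprn_ge0 ?subr_ge0 //.
  rewrite !hornerE distrC (le_trans _ (lerB_dist _ _)) // lerD2r.
  by rewrite sr // mem_head.
by apply: IH => z zr; rewrite sr // inE zr orbT.
Qed.

End Limits.

Local Open Scope classical_set_scope.
Local Open Scope ring_scope.
Local Open Scope complex_scope.

(** * The pointwise bound on the torus *)

Section Poles.
Variable R : realType.
Implicit Types (a b w : R[i]) (N Q : {poly R[i]}).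

(** The Cayley transform turns a half-plane condition into a comparison of norms, ready for
    [norm_le_limit]. *)
Lemma Re_div_ge0 a b : b != 0 ->
  (0 <= complex.Re (a / b)) = (`|a - b| <= `|a + b|).
Proof.
move=> b0; have nb : 0 < `|b| by rewrite normr_gt0.
have -> : a - b = (a / b - 1) * b by rewrite mulrBl mul1r divfK.
have -> : a + b = (a / b + 1) * b by rewrite mulrDl mul1r divfK.
rewrite !normrM ler_pM2r //; case: (a / b) => x y.
rewrite !normc_def /= lecR ler_sqrt ?addr_ge0 ?sqr_ge0 // oppr0 !addr0 lerD2r.
rewrite -[RHS]subr_ge0 (_ : (x + 1) ^+ 2 - _ = 4 * x); last by ring.
by rewrite pmulr_rge0.
Qed.

Lemma expiD (s t : R) : expi (s + t) = expi s * expi t.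
Proof. by rewrite /expi cosD sinD [X in _ +i* X]addrC. Qed.

Lemma expiMn (t : R) m : expi (t *+ m) = expi t ^+ m.
Proof.
elim: m => [|m IH]; last by rewrite mulrS expiD IH exprS.
by rewrite mulr0n expr0 /expi cos0 sin0.
Qed.

Lemma norm_expi (t : R) : `|expi t| = 1.
Proof. by rewrite normc_def /= cos2Dsin2 sqrtr1. Qed.

Lemma expi_neq0 (t : R) : expi t != 0.
Proof. by rewrite -normr_gt0 norm_expi ltr01. Qed.

(** Up to the factor [cos t > 0], the real part is [x + y * tan t]; if [y] were nonzero, the angle
    with tangent [- (x + 1) / y] would give [-1]. *)
Lemma Re_sector_ge0 b :
  (forall t : R, - (pi / 2) < t < pi / 2 -> 0 <= complex.Re (b / expi t)) -> 0 <= b.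
Proof.
move=> H; case: b H => x y H.
have {}H t : - (pi / 2) < t < pi / 2 -> 0 <= x + y * tan t.
  move=> ht; have ct := cos_gt0_pihalf ht.
  have := H t ht; rewrite invc_norm norm_expi expr1n invr1 mul1r /=.
  rewrite mulrN opprK /tan mulrA => le.
  by rewrite -(pmulr_lge0 _ ct) mulrDl divfK ?gt_eqF.
have hx : 0 <= x.
  have := H 0; rewrite tan0 mulr0 addr0; apply.
  by rewrite oppr_lt0 divr_gt0 // pi_gt0.
suff y0 : y = 0 by rewrite y0 lecE /= eqxx.
apply/eqP/negPn/negP => y0.
have := H (atan (- (x + 1) / y)); rewrite atan_gtNpi2 atan_ltpi2 atanK => /(_ isT).
rewrite mulrC divfK // opprD addNKr.
by rewrite oppr_ge0 ler10.
Qed.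

(* Let [t] tend to [1] along the rays [t = 1 - rho * expi th]: the sign
   condition survives in every direction of the open half-disk, which leaves no
   room for an argument of the leading Laurent coefficient at [1]. *)
Lemma pole_coef_ge0 N Q Q1 (m : nat) :
  Q = Q1 * ('X - 1%:P) ^+ m -> (0 < m)%N -> Q1.[1] != 0 ->
  (forall t, `|t| < 1 -> Q.[t] != 0 /\ 0 <= complex.Re (N.[t] / Q.[t])) ->
  0 <= (-1) ^+ m * N.[1] / Q1.[1].
Proof.
move=> eQ m0 Q11 H; apply: Re_sector_ge0 => t ht.
(* Approaching in direction [th] rotates a pole of order [m] by [m * th], that is, by [t]. *)
pose th := t / m%:R.
have m0' : 0 < m%:R :> R by rewrite ltr0n.
have hth : - (pi / 2) < th < pi / 2.
  have pi2 : 0 < pi / 2 :> R by rewrite divr_gt0 // pi_gt0.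
  have m1 : 1 <= m%:R :> R by rewrite ler1n.
  rewrite /th ltr_pdivrMr // ltr_pdivlMr //; move: ht => /andP [h1 h2].
  rewrite (le_lt_trans _ h1) ?(lt_le_trans h2) //.
    by rewrite ler_peMr // ltW.
  by rewrite mulNr lerN2 ler_peMr // ltW.
have cth := cos_gt0_pihalf hth.
pose d := expi th.
have dm : d ^+ m = expi t by rewrite /d -expiMn /th -(mulr_natr (t / m%:R)) divfK ?gt_eqF.
have dn0 : d != 0 by exact: expi_neq0.
pose c : R[i] := (- d) ^+ m.
have c0 : c != 0 by rewrite expf_neq0 // oppr_eq0.
have -> : (-1) ^+ m * N.[1] / Q1.[1] / expi t = N.[1] / (c * Q1.[1]).
  rewrite -dm /c (exprNn d).
  have : (-1 : R[i]) ^+ m != 0 by rewrite expf_neq0 // oppr_eq0 oner_eq0.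
  have : ((-1 : R[i]) ^+ m) ^+ 2 = 1 by rewrite -exprM mulnC exprM sqrrN expr1n expr1n.
  move: ((-1) ^+ m) (d ^+ m) (expf_neq0 m dn0) => e D D0 e2 e0.
  have ei : e = e^-1 by apply: (mulfI e0); rewrite -expr2 e2 divff.
  by rewrite [in LHS]ei; field; rewrite Q11 D0 e0.
rewrite Re_div_ge0 ?mulf_neq0 //.
have -> : N.[1] - c * Q1.[1] = (N - c%:P * Q1).[1].
  by rewrite !(hornerD, hornerN, hornerM, hornerC).
have -> : N.[1] + c * Q1.[1] = (N + c%:P * Q1).[1].
  by rewrite !(hornerD, hornerN, hornerM, hornerC).
apply: norm_le_limit => e e0 e1.
have [er ee] : exists r : R, e = r%:C.
  by apply/complex_realP; rewrite ger0_real // ltW.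
(* The squared modulus of [1 - rho * d] is [1 - rho * (2 cos th - rho)], so this choice stays in the
   disk. *)
pose rho := Num.min er (cos th).
have er0 : 0 < er by rewrite -ltcR -ee.
have rho0 : 0 < rho by rewrite lt_min er0 cth.
have rhoe : rho <= er by rewrite ge_min lexx.
have rhoc : rho <= cos th by rewrite ge_min lexx orbT.
exists (- (rho%:C * d)); split.
  rewrite normrN normrM norm_expi mulr1 normc_def /= expr0n addr0 sqrtr_sqr.
  by rewrite gtr0_norm // ee lecR.
set s := 1 + _.
have ns : `|s| < 1.
  have es : s = (1 - rho * cos th) +i* (- (rho * sin th)).
    by apply/eqP; rewrite eq_complex /= !mul0r subr0 addr0 add0r !eqxx.
  rewrite es normc_def /= ltcR -[ltRHS]sqrtr1 ltr_sqrt // sqrrN.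
  have -> : (1 - rho * cos th) ^+ 2 + (rho * sin th) ^+ 2 =
     1 - rho * (2 * cos th - rho * (cos th ^+ 2 + sin th ^+ 2)) by ring.
  rewrite cos2Dsin2 mulr1 gtrBl mulr_gt0 // subr_gt0 (le_lt_trans rhoc) //.
  by rewrite mulr_natl mulr2n ltrDl.
have [Qs] := H s ns.
have rr0 : (rho%:C : R[i]) ^+ m != 0.
  by rewrite expf_neq0 // eq_complex /= gt_eqF.
have Qse : Q.[s] = (rho%:C) ^+ m * (c * Q1.[s]).
  have s1 : s - 1 = rho%:C * - d by rewrite /s addrAC subrr add0r mulrN.
  by rewrite eQ hornerM horner_exp hornerXsubC s1 exprMn -/c; ring.
rewrite !(hornerD, hornerN, hornerM, hornerC).
move: Qs; rewrite Qse !mulf_eq0 !negb_or => /and3P [_ _ Q1s].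
rewrite -Re_div_ge0 ?mulf_neq0 // => le.
have -> : N.[s] / (c * Q1.[s]) = (rho ^+ m)%:C * (N.[s] / (rho%:C ^+ m * (c * Q1.[s]))).
  by rewrite rmorphXn /=; field; rewrite rr0 c0 Q1s.
rewrite -[X in 0 <= X]/(complex.Re _).
move: (N.[s] / _) le => [x y] /= le.
by rewrite mul0r subr0 mulr_ge0 // exprn_ge0 // ltW.
Qed.

End Poles.

Section Torus.
Variable R : realType.
Local Notation K := R[i].
Implicit Types (p q v : {poly {poly K}}) (n : nat * nat) (x y : K).

Lemma reflect_coef n q i j :
  (reflect_poly n q)`_i`_j =
    if (i <= n.1)%N && (j <= n.2)%N then (q`_(n.1 - i)`_(n.2 - j))^* else 0.
Proof.
rewrite /reflect_poly coef_poly ltnS; case: leqP => _ /=; last by rewrite coef0.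
by rewrite coef_poly ltnS.
Qed.

Lemma bidegree_leP n q :
  bidegree_le n q <-> forall i j, (n.1 < i)%N || (n.2 < j)%N -> q`_i`_j = 0.
Proof.
split=> [[s1 s2] i j /orP [lt|lt]|H].
- by rewrite (nth_default _ (leq_trans s1 lt)) coef0.
- by rewrite nth_default // (leq_trans _ lt) // (leq_trans (max_size_coefXY _ _)).
split; first by apply/leq_sizeP => i lt; apply/polyP => j; rewrite coef0 H // lt.
apply/bigmax_leqP => i _; apply/leq_sizeP => j lt.
by rewrite H // lt orbT.
Qed.

Lemma bidegree_le_reflect n q : bidegree_le n (reflect_poly n q).
Proof.
apply/bidegree_leP => i j; rewrite reflect_coef !ltnNge -negb_and.
by move=> /negPf ->.
Qed.

Lemma bidegree_leB n p q : bidegree_le n p -> bidegree_le n q -> bidegree_le n (p - q).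
Proof.
move=> /bidegree_leP hp /bidegree_leP hq; apply/bidegree_leP => i j lt.
by rewrite !coefB hp // hq // subr0.
Qed.

Lemma reflect_subr_reflect n p : bidegree_le n p ->
  reflect_poly n (p - reflect_poly n p) = - (p - reflect_poly n p).
Proof.
move=> /bidegree_leP hp; apply/polyP => i; apply/polyP => j.
rewrite reflect_coef !coefN !coefB !reflect_coef !leq_subr /=.
case: andP => [[i1 j1]|nij]; first by rewrite !subKn // rmorphB /= conjcK opprB.
rewrite hp ?subr0 ?oppr0 //; apply/orP.
have [i1|] := leqP i n.1; [right | by left].
by rewrite ltnNge; apply/negP => j1; apply: nij.
Qed.

Lemma torus_conjV x : `|x| = 1 -> (x^*)^-1 = x.
Proof.
move=> x1; have x0 : x != 0 by rewrite -normr_gt0 x1 ltr01.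
have c0 : x^* != 0 by rewrite conjc_eq0.
by apply: (mulfI c0); rewrite divff // mulrC -sqr_normc x1 expr1n.
Qed.

Section Antisymmetric.
Variables (n : nat * nat) (q : {poly {poly K}}).
Hypotheses (qn : bidegree_le n q) (q_anti : reflect_poly n q = - q).
Hypothesis (q_free : zero_free_bidisk q).

Lemma horner_coef0_outer x : (q`_0).[x] = q.[0, x].
Proof. by rewrite -horner_coef0 polyC0. Qed.

Lemma anti_lead x : `|x| = 1 -> (q`_n.1).[x] = - (x ^+ n.2 * (q.[0, x])^*).
Proof.
move=> x1; have x0 : x != 0 by rewrite -normr_gt0 x1 ltr01.
have xV := torus_conjV x1.
have c0 : bidegree_le (0, n.2) (q`_0)%:P.
  split; first exact: size_polyC_leq1.
  apply/bigmax_leqP => i _; rewrite coefC; case: eqP => _; last by rewrite size_poly0.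
  by case: qn => _; apply: leq_trans; exact: max_size_coefXY.
have e : reflect_poly (0, n.2) (q`_0)%:P = (- q`_n.1)%:P.
  apply/polyP => -[|i]; apply/polyP => j; rewrite reflect_coef !coefC /= ?if_same //.
  have eq : q = - reflect_poly n q by rewrite q_anti opprK.
  rewrite coefN [q in RHS]eq !coefN reflect_coef leqnn subnn opprK.
  by case: leqP.
have := horner2_reflect c0 (oner_neq0 K) x0.
rewrite e !hornerC hornerN /= expr0 mul1r xV horner_coef0_outer => /eqP.
by rewrite eqr_oppLR => /eqP.
Qed.

(** By antisymmetry the top coefficient of [q] is minus the conjugate of [q(0, 0)], nonzero by
    [q_free]. *)
Lemma anti_size : size q = n.1.+1.
Proof.
case: (qn) => s1 _; apply/anti_leq; rewrite s1 ltnNge; apply/negP => s2.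
have := q_free (z := (0, 0)); rewrite /bidisk /= normr0 ltr01 => /(_ (conj isT isT)).
rewrite -[q in q.[_, _]]opprK -q_anti hornerN hornerN oppr_eq0.
rewrite polyC0 !horner_coef0 reflect_coef /= !subn0.
by rewrite (nth_default _ s2) coef0 conjc0 eqxx.
Qed.

Lemma anti_lead_coef : lead_coef q = q`_n.1.
Proof. by rewrite lead_coefE anti_size. Qed.

(** For [w = (1 - e) * x] the fibre has no root in the disk, so [horner_lower_bound] applies;
    letting [e] tend to 0 keeps the bound positive, since the leading coefficient at [x] has modulus
    [|q(0, x)|]. *)
Lemma anti_root_ge1 x y : `|x| = 1 -> q.[0, x] != 0 -> q.[y, x] = 0 -> 1 <= `|y|.
Proof.
move=> x1 q0 qy; rewrite real_leNgt ?normr_real ?real1 //; apply/negP => y1.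
have y1' : 0 < 1 - `|y| by rewrite subr_gt0.
pose c := (1 - `|y|) ^+ n.1.
have c0 : 0 < c by rewrite exprn_gt0.
suff : `|(c%:P * lead_coef q).[x]| <= `|q.[y%:P].[x]|.
  rewrite qy normr0 normr_le0 hornerM hornerC mulf_eq0 gt_eqF //=.
  rewrite anti_lead_coef anti_lead // oppr_eq0 mulf_eq0 expf_eq0 conjc_eq0 (negPf q0).
  by rewrite -normr_eq0 x1 oner_eq0 andbF.
apply: norm_le_limit => e e0 e1; exists (- (e * x)).
have -> : x + - (e * x) = (1 - e) * x by rewrite mulrBl mul1r.
split; first by rewrite normrN normrM x1 mulr1 gtr0_norm.
set w := (1 - e) * x.
have w1 : `|w| < 1.
  by rewrite normrM x1 mulr1 ger0_norm ?subr_ge0 // gtrBl.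
have [lw|lw] := eqVneq (lead_coef q).[w] 0.
  by rewrite hornerM lw mulr0 normr0.
have lf : lead_coef (fibre w q) = (lead_coef q).[w].
  by rewrite lead_coef_map_id0 // /horner_eval ?horner0.
have sf : size (fibre w q) = n.1.+1.
  by rewrite size_map_poly_id0 // anti_size.
rewrite hornerM hornerC normrM (gtr0_norm c0) mulrC -lf -fibreE.
have -> : c = (1 - `|y|) ^+ (size (fibre w q)).-1 by rewrite sf.
apply: horner_lower_bound; last exact: ltW.
by move=> x' x'1; rewrite fibreE; apply: (q_free (z := (x', w))).
Qed.

(** The reflected point [1 / conj y] is also a root over [x], and the lower bound applies to
    both. *)
Lemma anti_root_torus x y : `|x| = 1 -> q.[0, x] != 0 -> q.[y, x] = 0 -> `|y| = 1.
Proof.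
move=> x1 q0 qy; apply/eqP; rewrite eq_le.
apply/andP; split; last exact: anti_root_ge1 q0 qy.
have y0 : y != 0 by apply: contra_neq q0 => y0; rewrite -[RHS]qy y0.
have x0 : x != 0 by rewrite -normr_gt0 x1 ltr01.
have xV := torus_conjV x1.
have w0 : ((y^*)^-1 : K) != 0 by rewrite invr_eq0 conjc_eq0.
have qw : q.[(y^*)^-1, x] = 0.
  have wV : ((((y^*)^-1)^*)^-1 : K) = y.
    by rewrite fmorphV invrK; exact: conjCK.
  move: w0 wV; set w : K := (y^*)^-1 => w0 wV.
  have e : (reflect_poly n q).[w, x] =
      w ^+ n.1 * x ^+ n.2 * (q.[(w^*)^-1, (x^*)^-1])^* := horner2_reflect qn w0 x0.
  move: e; rewrite wV xV qy rmorph0 mulr0 q_anti !hornerN => /eqP.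
  by rewrite oppr_eq0 => /eqP.
have := anti_root_ge1 x1 q0 qw.
by rewrite normfV norm_conjC invf_ge1 ?normr_gt0.
Qed.

End Antisymmetric.

Section Slice.
Variables (x y : K).

Definition slice (h : {poly {poly K}}) : {poly K} :=
  (map_poly (comp_poly (x *: 'X)) h).[y *: 'X].

Lemma slice_horner h t : (slice h).[t] = h.[t * y, t * x].
Proof.
rewrite /slice -[LHS]/(horner_eval t _) -horner_map /= -map_poly_comp.
rewrite /horner_eval hornerZ hornerX [y * t]mulrC -fibreE.
congr (_.[_]); apply: eq_map_poly => c /=.
by rewrite /horner_eval horner_comp hornerZ hornerX [x * t]mulrC.
Qed.

End Slice.

(** On the complex disk through the point, [G / Q] and [(k P - G) / Q] share the pole order bound
    [m] and the cofactor [Q1]; [0 <= A G <= k A P] then compares the numerators at the boundary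
    point. *)
Lemma quotient_bound (k : R) (P Q G : {poly {poly K}}) x y :
  0 <= k -> `|x| = 1 -> `|y| = 1 -> Q.[y, x] = 0 ->
  (forall z, bidisk z -> [/\ Q.[z.1, z.2] != 0,
     0 <= complex.Re (G.[z.1, z.2] / Q.[z.1, z.2]) &
     complex.Re (G.[z.1, z.2] / Q.[z.1, z.2]) <=
       k * complex.Re (P.[z.1, z.2] / Q.[z.1, z.2])]) ->
  `|G.[y, x]| <= k%:C * `|P.[y, x]|.
Proof.
move=> k0 x1 y1 Q0 H.
pose Qs := slice x y Q; pose Ps := slice x y P; pose Gs := slice x y G.
have disk t : `|t| < 1 -> bidisk ((t * y, t * x) : R[i]^o * R[i]^o).
  by move=> t1; split; rewrite /= normrM ?x1 ?y1 mulr1.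
have Qs0 : Qs != 0.
  have [] := H (0, 0); first by rewrite /bidisk /= normr0 ltr01.
  move=> Q00 _ _; apply: contraNneq Q00 => Qs0.
  have := slice_horner x y Q 0; rewrite -/Qs Qs0 horner0 !mul0r => e.
  by rewrite -e.
have [m [Q1 /implyP /(_ Qs0) Q11 eQ]] := multiplicity_XsubC Qs 1.
have m0 : (0 < m)%N.
  rewrite lt0n; apply: contra Q11 => /eqP m0; move: eQ; rewrite m0 expr0 mulr1 => <-.
  by rewrite rootE slice_horner !mul1r Q0.
pose A (N : {poly K}) := (-1) ^+ m * N.[1] / Q1.[1].
have AG : 0 <= A Gs.
  apply: (pole_coef_ge0 eQ m0 Q11) => t /disk /H [Qt G0 _].
  by rewrite !slice_horner.
have AP : 0 <= A (k%:C *: Ps - Gs).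
  apply: (pole_coef_ge0 eQ m0 Q11) => t /disk /H [Qt _ GP].
  rewrite !hornerE !slice_horner; split=> //.
  rewrite mulrBl -mulrA.
  move: GP; move: (P.[_, _] / _) (G.[_, _] / _) => [a1 a2] [b1 b2] /=.
  by rewrite mul0r subr0 subr_ge0.
have nA N : `|A N| = `|N.[1]| / `|Q1.[1]|.
  by rewrite /A !normrM normrX normrN1 expr1n mul1r normfV.
have : `|A Gs| <= k%:C * `|A Ps|.
  have eA : A (k%:C *: Ps - Gs) = k%:C * A Ps - A Gs.
    by rewrite /A !(hornerD, hornerN, hornerZ); ring.
  move: AP; rewrite eA subr_ge0 (ger0_norm AG) => le.
  by rewrite -[k%:C]ger0_norm ?ler0c // -normrM ger0_norm // (le_trans _ le).
by rewrite !nA mulrA ler_pM2r ?invr_gt0 ?normr_gt0 // !slice_horner !mul1r.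
Qed.

(** Positivity of both endpoints bounds [Re a] by [Re f / (1 - s)] and [Re b] by [Re f / s]; [g] is
    a convex combination of [a] and [b]. *)
Lemma face_Re_bound (S : set (R[i]^o * R[i]^o -> R[i]^o)) f g :
  S `<=` @PRP2 R -> face S f g ->
  exists k : R, 0 <= k /\ forall z, bidisk z ->
    0 <= complex.Re (g z) /\ complex.Re (g z) <= k * complex.Re (f z).
Proof.
move=> SP [[a [b [[ab sub [s /andP [s0 s1] ef]] [t /andP [t0 t1] eg]]]]|[[Sf _] ->]]; last first.
  exists 1; split=> // z zD; rewrite mul1r lexx; split=> //.
  by have [_ _ Rf _] := SP _ Sf; apply/ltW/Rf.
have [_ _ Ra _] : PRP2 a.
  by apply/SP/sub; exists 0; rewrite ?lexx ?ler01 // subr0 scale1r scale0r addr0.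
have [_ _ Rb _] : PRP2 b.
  by apply/SP/sub; exists 1; rewrite ?lexx ?ler01 // subrr scale1r scale0r add0r.
have s1' : 0 < 1 - s by rewrite subr_gt0.
have t1' : 0 <= 1 - t by rewrite subr_ge0.
exists ((1 - s)^-1 + s^-1); split; first by rewrite addr_ge0 // invr_ge0 ltW.
move=> z zD.
have comb r : complex.Re (((1 - r)%:C *: a + r%:C *: b) z) =
    (1 - r) * complex.Re (a z) + r * complex.Re (b z).
  rewrite -[(_ + _) z]/(_ *: a z + _ *: b z).
  by case: (a z) (b z) => [? ?] [? ?] /=; rewrite !mul0r !subr0.
rewrite ef eg !comb; have := Ra z zD; have := Rb z zD.
move: (complex.Re (a z)) (complex.Re (b z)) => A B B0 A0.
split; first by rewrite addr_ge0 // mulr_ge0 // ltW.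
rewrite [leRHS]mulrDl; apply: lerD.
  rewrite (le_trans (_ : _ <= A)) ?ler_piMl ?gerBl //; first exact: ltW.
  by rewrite mulrDr mulrA mulVf ?gt_eqF // mul1r lerDl !mulr_ge0 ?invr_ge0 // ltW.
rewrite (le_trans (_ : _ <= B)) ?ler_piMl //; first exact: ltW.
by rewrite mulrDr addrC mulrA mulVf ?gt_eqF // mul1r lerDl !mulr_ge0 ?invr_ge0 // ltW.
Qed.

End Torus.

(** * Comparison of the multiplicities *)

Lemma mulr_comb_div (L : fieldType) (u v a b x y : L) : u != 0 -> v != 0 ->
  u * v * (a / u * x + b / v * y) = a * v * x + b * u * y.
Proof. by move=> u0 v0; field; rewrite u0 v0. Qed.

Section Fractions.
Variable A : idomainType.
Local Notation "x %:F" := (@FracField.tofrac A x).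
Implicit Types a b c d s x y : A.

Lemma tofrac_div_eq a b c d : b != 0 -> d != 0 -> a * d = c * b ->
  a%:F / b%:F = c%:F / d%:F.
Proof.
move=> b0 d0 e; apply/eqP; rewrite eqr_div ?tofrac_eq0 //.
by rewrite -!tofracM e.
Qed.

Lemma tofrac_comb a b c d s x y : s != 0 -> d != 0 -> s * c = a * x + b * y ->
  c%:F / d%:F = a%:F / (s * d)%:F * x%:F + b%:F / (s * d)%:F * y%:F.
Proof.
move=> s0 d0 e; rewrite ![_ / _ * _]mulrAC -mulrDl -!tofracM -tofracD -e.
by apply: tofrac_div_eq => //; [exact: mulf_neq0 | ring].
Qed.

Lemma tofrac_comb_clear a1 a2 b1 b2 c x y : a2 != 0 -> b2 != 0 ->
  c%:F = a1%:F / a2%:F * x%:F + b1%:F / b2%:F * y%:F ->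
  a2 * b2 * c = a1 * b2 * x + b1 * a2 * y.
Proof.
move=> a0 b0 e; apply/eqP; rewrite -tofrac_eq tofracM e.
by rewrite !(tofracM, tofracD) mulr_comb_div ?tofrac_eq0.
Qed.

End Fractions.

Section Dimension.
Variables (R : realType) (z : R[i] * R[i]).
Local Notation K := R[i].
Local Notation Rg := {poly {poly K}}.
Local Notation "x %:F" := (@FracField.tofrac Rg x).
Implicit Types (p q u h : Rg).

Lemma unit_at_neq0 (s : Rg) : unit_at z s -> s != 0.
Proof. by apply: contraTneq => ->; rewrite /unit_at !horner0 eqxx. Qed.

Lemma unit_at_prod (I : Type) (r : seq I) (P : pred I) (b : I -> Rg) :
  (forall i, unit_at z (b i)) -> unit_at z (\prod_(i <- r | P i) b i).
Proof.
move=> H; apply: (big_ind (unit_at z)) => [|x y|i _]; last exact: H.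
  exact: unit_at1.
exact: unit_atM.
Qed.

(** All members are multiplied by one common denominator, a unit of the local ring. *)
Lemma free_mod_clear p q k (e : 'I_k -> {fraction Rg}) :
  (forall i, local_ring z (e i)) -> free_mod (local_ideal z p q) e ->
  exists e' : 'I_k -> Rg, lin_free (loc_ideal z p q) e'.
Proof.
move=> /choice [a] /choice [b ab] fe.
have bu i : unit_at z (b i) by have [] := ab i.
pose B := \prod_i b i; pose E i := a i * \prod_(j | j != i) b j.
have Bu : unit_at z B by exact: unit_at_prod.
have eE i : e i = (E i)%:F / B%:F.
  have [_ ->] := ab i; apply: tofrac_div_eq; rewrite ?unit_at_neq0 //.
  by rewrite /E /B (bigD1 i) //=; ring.
exists E => c [s [al [be [us eq]]]]; apply: fe.
have usB := unit_atM us Bu.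
exists (al%:F / (s * B)%:F), (be%:F / (s * B)%:F); split.
- by exists al, (s * B).
- by exists be, (s * B).
rewrite -(tofrac_comb _ _ eq) ?unit_at_neq0 // rmorph_sum mulr_suml.
by apply: eq_bigr => i _ /=; rewrite eE mulrA -tofracM.
Qed.

Lemma free_mod_tofrac p q k (e : 'I_k -> Rg) :
  lin_free (loc_ideal z p q) e ->
  (forall i, local_ring z (e i)%:F) /\
  free_mod (local_ideal z p q) (fun i => (e i)%:F).
Proof.
move=> fe; split=> [i|c [x [y [[a1 [a2 [ua ->]]] [b1 [b2 [ub ->]]] eq]]]].
  by exists (e i), 1; split; [exact: unit_at1 | rewrite tofrac1 divr1].
apply: fe; exists (a2 * b2), (a1 * b2), (b1 * a2); split; first exact: unit_atM.
apply: tofrac_comb_clear; rewrite ?unit_at_neq0 // -eq rmorph_sum.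
by apply: eq_bigr => i _; rewrite /= tofracM.
Qed.

Lemma intersection_mult_le p q p' q' :
  (forall k (e : 'I_k -> Rg), lin_free (loc_ideal z p q) e ->
     exists e' : 'I_k -> Rg, lin_free (loc_ideal z p' q') e') ->
  (intersection_mult z p q <= intersection_mult z p' q')%E.
Proof.
move=> H; apply: le_ereal_sup => _ [k [e [le fe]] <-]; exists k => //.
have [e1 /H [e2 fe2]] := free_mod_clear le fe.
by exists (fun i => (e2 i)%:F); exact: free_mod_tofrac.
Qed.

Lemma loc_ideal_sub p q q' h : q = p - q' -> loc_ideal z p q h -> loc_ideal z p q' h.
Proof.
move=> -> [s [a [b [us e]]]]; exists s, (a + b), (- b); split=> //.
by rewrite e; ring.
Qed.

End Dimension.

Section Integrality.
Variables (R : realType) (n : nat * nat) (z : R[i] * R[i]).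
Variables (p q u : {poly {poly R[i]}}) (k : R).
Local Notation K := R[i].
Local Notation Rg := {poly {poly K}}.
Hypotheses (qn : bidegree_le n q) (q_anti : reflect_poly n q = - q).
Hypothesis (q_free : zero_free_bidisk q).
Hypotheses (p0 : p != 0) (q0 : q != 0) (co : coprime2 p q).
Hypotheses (z1 : `|z.1| = 1) (z2 : `|z.2| = 1).
Hypothesis (k0 : 0 <= k).
Hypothesis (bound : forall x y : K, `|x| = 1 -> `|y| = 1 -> q.[y, x] = 0 ->
  `|u.[y, x]| <= k%:C * `|p.[y, x]|).

(** Here [q] vanishes on a whole circle of torus points over [z.2], so [u / p] is bounded on it and
    regular at [z.1]: an integral equation of degree one. *)
Lemma integral_over_vertical : fibre z.2 q = 0 ->
  integral_over z p u ('X - (z.2)%:P)%:P.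
Proof.
move=> fq; have fp := coprime2_fibre co fq.
have [e [c [ez ec]]] : exists e c, e.[z.1] != 0 /\ e * fibre z.2 u = c * fibre z.2 p.
  apply: (circle_regular (k := k%:C) z1 fp (oner_neq0 _)) => y y1 _.
  by rewrite !fibreE; apply: bound => //; rewrite -fibreE fq horner0.
have [h eh] : exists h, map_poly polyC e * u - map_poly polyC c * p = ('X - (z.2)%:P)%:P * h.
  apply: fibre_eq0; rewrite fibreB !fibreM.
  have lift w : fibre z.2 (map_poly polyC w) = w.
    rewrite /fibre -map_poly_comp (eq_map_poly (g := id)) ?map_poly_id // => x /=.
    by rewrite /horner_eval hornerC.
  by rewrite !lift ec subrr.
exists 0%N, (map_poly polyC e), (map_poly polyC c), h; split=> //.
  by rewrite unit_at_map_polyC.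
by rewrite expr1 -eh; ring.
Qed.

Lemma integral_over_at : integral_over z p u q.
Proof.
have [b [q' [eq fq']]] := fibre_split z.2 q0.
have [r [al [be [r0 er]]]] := coprime2_elim p0 q0 co.
have q'_int : integral_over z p u q'.
  (* Finitely many values of z_2 are excluded: the zeros of [q(0, .)], where roots may leave the
     circle, those of the eliminant [r], over which [p] and [q] may meet, and [z.2]. *)
  pose E := q`_0 * r * ('X - (z.2)%:P).
  have q00 : q`_0 != 0.
    have := q_free (z := (0, 0)); rewrite /bidisk /= normr0 ltr01 => /(_ (conj isT isT)).
    by apply: contraNneq => e; rewrite -horner_coef0_outer e horner0.
  have E0 : E != 0 by rewrite !mulf_neq0 ?polyXsubC_eq0.
  have EE x : E.[x] != 0 -> [/\ q.[0, x] != 0, r.[x] != 0 & x != z.2].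
    rewrite /E !hornerM horner_coef0_outer hornerXsubC !mulf_eq0 !negb_or subr_eq0.
    by move=> /andP [/andP [? ?] ?].
  apply: (integral_over_companion (good := fun x => `|x| = 1 /\ E.[x] != 0) (kb := k%:C) fq').
  - by rewrite ler0c.
  - move=> x y [x1 /EE [q0x rx _]] q'y.
    have qy : q.[y, x] = 0 by rewrite eq !hornerM q'y mulr0.
    have y1 := anti_root_torus qn q_anti q_free x1 q0x qy.
    split; last exact: bound.
    apply: contraNneq rx => py; have := congr1 (fun P : Rg => P.[y, x]) er.
    by rewrite /= hornerC !hornerE py qy !mulr0 addr0 => ->.
  - move=> c c0; have [x [x1]] := circle_nonroot (mulf_neq0 c0 E0).
    by rewrite hornerM mulf_eq0 negb_or => /andP [cx Ex]; exists x.
  move=> a b' c k' b'0 c0 H; apply: (circle_regular (k := k') z2 b'0 (mulf_neq0 c0 E0)).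
  move=> x x1; rewrite hornerM mulf_eq0 negb_or => /andP [cx Ex].
  exact: H.
rewrite eq; case: b eq => [|b] eq; first by rewrite expr0 mul1r.
have t_int : integral_over z p u ('X - (z.2)%:P)%:P.
  by apply: integral_over_vertical; rewrite eq exprS -mulrA fibreM fibre_XsubC mul0r.
apply: integral_overM => //; clear eq.
elim: b => [|b IH]; first by rewrite expr1.
by rewrite exprS; exact: integral_overM.
Qed.

End Integrality.

Theorem theorem1p6 (R : realType) (n : nat * nat)
    (p v : {poly {poly R[i]}}) (f g : R[i]^o * R[i]^o -> R[i]^o)
    (z : R[i] * R[i]) :
  let pt := reflect_poly n p in
  bidegree n p ->
  scattering_stable n p ->
  f = frac_bidisk (p + pt) (p - pt) ->
  PRPR2 f ->
  bidegree_le n v ->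
  v = reflect_poly n v ->
  v.[0, 0] = 0 ->
  (exists a : R, [/\ 0 < a, zero_free_bidisk (p + v)
                   & zero_free_bidisk (p - (a%:C)%:P%:P * v)]) ->
  g = (fun w => f w + 2 * frac_bidisk v (p - pt) w) ->
  face (@PRP2 R) f g ->
  torus z ->
  p.[z.1, z.2] = 0 ->
  (intersection_mult z p pt <= intersection_mult z (p + v)%R (pt + v)%R)%E.
Proof.
move=> pt [sp1 sp2] [p_free co] ef [[_ _ Rf _] _] _ _ _ _ eg fg [z1 z2] _.
pose q := p - pt.
have pn : bidegree_le n p by rewrite /bidegree_le sp1 sp2.
have qn : bidegree_le n q by apply: bidegree_leB => //; exact: bidegree_le_reflect.
have q_anti : reflect_poly n q = - q by exact: reflect_subr_reflect.
have fE w : bidisk w -> f w = (p + pt).[w.1, w.2] / q.[w.1, w.2].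
  by move=> wD; rewrite ef /frac_bidisk /on_bidisk patchE mem_set.
have q_free : zero_free_bidisk q.
  move=> w wD; apply/eqP => q0; have := Rf w wD.
  by rewrite fE // q0 invr0 mulr0 ltxx.
have p0 : p != 0 by rewrite -size_poly_eq0 sp1.
have q0 : q != 0.
  apply/eqP => q0; have := q_free (0, 0); rewrite q0 !horner0 eqxx.
  by rewrite /bidisk /= normr0 ltr01 => /(_ (conj isT isT)).
have cop : coprime2 p q.
  move=> d a b epd eqd; apply: (co d a (a - b)) => //.
  by rewrite mulrBl -epd -eqd /q opprB addrC subrK.
have [k [k0 Hk]] := face_Re_bound (@subset_refl _ _) fg.
have bound (x y : R[i]) : `|x| = 1 -> `|y| = 1 -> q.[y, x] = 0 ->
    `|(p + v).[y, x]| <= k%:C * `|p.[y, x]|.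
  move=> x1 y1 qy.
  (* These are the numerators of [f] and [g] over [q]; where [q] vanishes [pt] equals [p], and they
     become [2 p] and [2 (p + v)]. *)
  have := @quotient_bound _ k (p + pt) q (p + pt + (v + v)) x y k0 x1 y1 qy.
  have -> : (p + pt).[y, x] = 2 * p.[y, x].
    by move: qy; rewrite /q !(hornerD, hornerN) => /subr0_eq ->; ring.
  have -> : (p + pt + (v + v)).[y, x] = 2 * (p + v).[y, x].
    by move: qy; rewrite /q !(hornerD, hornerN) => /subr0_eq ->; ring.
  rewrite !normrM normr_nat mulrCA ler_pM2l //; apply => w wD.
  have gE : g w = (p + pt + (v + v)).[w.1, w.2] / q.[w.1, w.2].
    rewrite eg fE // /frac_bidisk /on_bidisk patchE mem_set // -/q.
    by rewrite !(hornerD, mulrDl); ring.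
  by have [g0 gf] := Hk w wD; split; [exact: q_free | rewrite -gE | rewrite -gE -fE].
have int := integral_over_at qn q_anti q_free p0 q0 cop z1 z2 k0 bound.
have [A hA] := loc_ideal_t2 z p0 q0 cop.
have [B hB] := loc_ideal_t1 z p0 q0 cop.
apply: intersection_mult_le => j e fe.
have fe' : lin_free (loc_ideal z p q) e.
  by apply: lin_free_sub fe => h; exact: loc_ideal_sub.
have [e' fe2] := intersection_le (coprime2_regular z p0 q0 cop) hB hA int fe'.
(* Back from [q] to [pt + v], which is [(p + v) - q]. *)
exists e'; apply: lin_free_sub fe2 => h.
case=> s [a [b [us eh]]]; exists s, (a + b), (- b); split=> //.
by rewrite eh /q; ring.
Qed.
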